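(* Let $w\in\mathbb{C}$ and $a\in\mathbb{R}$. Then the generalized Hurwitz zeta function $\zeta_w(s,a)$ is an analytic function of $s$ in the half-plane $\mathrm{Re}(s)>1$.
   Context: Let $\mathfrak{B}=\{\xi\in\mathbb{C}:\mathrm{Re}(\xi)=1,\ \mathrm{Im}(\xi)\neq 0\}$. For $w\in\mathbb{C}\setminus\{0\}$, $\mathrm{Re}(s)>1$ and $a\in\mathbb{C}\setminus\mathfrak{B}$, the generalized Hurwitz zeta function is $$\zeta_w(s,a):=\frac{4}{w^2\sqrt{\pi}\,\Gamma\left(\frac{s+1}{2}\right)}\sum_{n=1}^{\infty}\int_{0}^{\infty}\int_{0}^{\infty}\frac{(uv)^{s-1}e^{-(u^2+v^2)}\sin(wv)\sinh(wu)}{\left(n^2u^2+(a-1)^2v^2\right)^{s/2}}\,du\,dv,$$ (principal branch of the power), and for $w=0$ one sets $\zeta_0(s,a):=\lim_{w\to0}\zeta_w(s,a)$ ($w=0$ is a removable singularity). *)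

(* Defs.v *)
From mathcomp Require Export all_boot all_order all_algebra complex.
From mathcomp Require Export all_classical all_reals all_analysis.
Export numFieldNormedType.Exports.
Export Order.TTheory GRing.Theory Num.Theory.

Set Implicit Arguments.
Unset Strict Implicit.
Unset Printing Implicit Defensive.

Local Open Scope classical_set_scope.
Local Open Scope ring_scope.
Local Open Scope complex_scope.

Section ComplexFunctions.
Context {R : realType}.
Implicit Types (z s : R[i]) (U : set R[i]).

Definition expC z : R[i] :=
  (expR (complex.Re z))%:C * (cos (complex.Im z) +i* sin (complex.Im z)).

Definition sinC z : R[i] := (expC ('i%C * z) - expC (- ('i%C * z))) / (2 * 'i%C).

Definition sinhC z : R[i] := (expC z - expC (- z)) / 2.

(* Principal argument: for z != 0, [acos] has values in [0, pi], so that
   [argC z] lies in ]-pi, pi]. *)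
Definition argC z : R :=
  let t := acos (complex.Re z / Normc.normc z) in
  if complex.Im z < 0 then - t else t.

Definition logC z : R[i] := ln (Normc.normc z) +i* argC z.

(* Principal branch of z ^ s, with the convention 0 ^ s = 0 for s != 0. *)
Definition powC z s : R[i] :=
  if z == 0 then (s == 0)%:R else expC (s * logC z).

(* On an open set, analyticity is complex differentiability at every point:
   R[i] is here a normed module over itself, so [derivable f z 1] says that
   (f (z + h) - f z) / h has a limit as the complex number h tends to 0. *)
Definition analytic_on U (f : R[i]^o -> R[i]^o) : Prop :=
  open (U : set R[i]^o) /\ (forall z, U z -> derivable f z 1).

End ComplexFunctions.

Section ComplexIntegral.
Context d (T : measurableType d) (R : realType).
Variable mu : {measure set T -> \bar R}.

Definition integrableC (D : set T) (f : T -> R[i]) : Prop :=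
  mu.-integrable D (fun x => (complex.Re (f x))%:E) /\
  mu.-integrable D (fun x => (complex.Im (f x))%:E).

Definition integralC (D : set T) (f : T -> R[i]) : R[i] :=
  Rintegral mu D (fun x => complex.Re (f x)) +i*
  Rintegral mu D (fun x => complex.Im (f x)).

End ComplexIntegral.

Section HurwitzZeta.
Context {R : realType}.
Implicit Types (w s a z : R[i]) (n : nat).

(* Euler's integral, which represents the Gamma function for Re z > 0;
   it is only used at (s + 1) / 2 with Re s > 1. *)
Definition GammaC z : R[i] :=
  integralC (@lebesgue_measure R) `]0, +oo[
    (fun t : R => powC t%:C (z - 1) * (expR (- t))%:C).

Definition zeta_integrand w s a n (p : R * R) : R[i] :=
  let u := p.1 in let v := p.2 in
  powC (u * v)%:C (s - 1) * (expR (- (u ^+ 2 + v ^+ 2)))%:C *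
    sinC (w * v%:C) * sinhC (w * u%:C) /
  powC ((n%:R * u%:C) ^+ 2 + (a - 1) ^+ 2 * v%:C ^+ 2) (s / 2).

Definition quadrant : set (R * R) := `]0, +oo[ `*` `]0, +oo[.

Definition plane_measure := (@lebesgue_measure R \x @lebesgue_measure R)%E.

Definition zeta_term w s a n : R[i] :=
  integralC plane_measure quadrant (zeta_integrand w s a n).

Definition zeta_partial w s a : nat -> R[i]^o :=
  fun N => \sum_(1 <= n < N) zeta_term w s a n.

(* Meaningful for w != 0, Re s > 1 and a outside {Re a = 1, Im a != 0}, where
   the base of the power in [zeta_integrand] avoids the branch cut. *)
Definition zeta_nz w s a : R[i]^o :=
  4 / (w ^+ 2 * (Num.sqrt pi)%:C * GammaC ((s + 1) / 2)) *
  limn (zeta_partial w s a).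

Definition hurwitz_zeta w s a : R[i]^o :=
  if w == 0 then lim (zeta_nz (w' : R[i]^o) s a @[w' --> (0 : R[i]^o)^'])
  else zeta_nz w s a.

(* [Rintegral] and [lim] are total, with junk values in case of divergence;
   [hurwitz_zeta_defined w s a] says that every integral, series and limit in
   [hurwitz_zeta w s a] exists. *)
Definition zeta_nz_defined w s a : Prop :=
  (forall n, (0 < n)%N ->
     integrableC plane_measure quadrant (zeta_integrand w s a n)) /\
  cvgn (zeta_partial w s a).

Definition hurwitz_zeta_defined w s a : Prop :=
  if w == 0 then
    (\forall w' \near (0 : R[i]^o)^', zeta_nz_defined w' s a) /\
    cvg (zeta_nz (w' : R[i]^o) s a @[w' --> (0 : R[i]^o)^'])
  else zeta_nz_defined w s a.

End HurwitzZeta.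

(* Main.v *)
(** On the quadrant the [n]-th integrand is [h(u,v) * exp (s * L_n(u,v))] with
   [L_n = ln (u v) - ln (n^2 u^2 + (a-1)^2 v^2) / 2] real and [h] independent of
   [s], and Gamma is of the same form [h * exp (s * L)] with [L = ln].  Since
   [L_n <= ln v - ln n], one has
   [|h| exp (y L_n) <= C(y) n^-y exp (-u-v)] for all [y > 1].  Then the remainder
   [exp (k L) - 1 - k L = O(|k|^2 L^2 exp (|k L|))] is dominated by the same
   bounds at [y + e] and [y - e], so each term, and by summability of [n^-y] the
   whole series, has a quadratic Taylor remainder in [s]; this is complex
   differentiability.

   The factor [1 / Gamma ((s+1)/2)] requires [Gamma z <> 0] for [Re z > 1]: a zero
   would propagate to all [z + n] by the functional equation, whereas for a
   large real part [x] the density [t^(x-1) exp (-t)] concentrates where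
   [|ln (t/x)|] is small, so that the oscillation [t^(i y)] cannot cancel it.

   At [w = 0], [sin (w v) sinh (w u) - w^2 u v] is [|w|^3] times a kernel of the
   same exponential type, so that [zeta_w] tends to the series with kernel
   [u v], which is analytic by the same argument. *)
Require Import Defs.
From mathcomp Require Import measurable_realfun ring lra.

Set Implicit Arguments.
Unset Strict Implicit.
Unset Printing Implicit Defensive.

Local Open Scope classical_set_scope.
Local Open Scope ring_scope.
Local Open Scope complex_scope.

(** * Complex exponential *)

Section ComplexExp.
Context {R : realType}.
Implicit Types (x y t : R) (z w : R[i]).
Local Notation nrm := Normc.normc.
Local Notation Re := complex.Re.
Local Notation Im := complex.Im.

Lemma normc_ge0 z : 0 <= nrm z.
Proof. by case: z => a b; exact: sqrtr_ge0. Qed.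

Lemma sqr_normcE z : nrm z ^+ 2 = Re z ^+ 2 + Im z ^+ 2.
Proof. by case: z => a b; rewrite sqr_sqrtr // addr_ge0 ?sqr_ge0. Qed.

Lemma normcRe z : `|Re z| <= nrm z.
Proof.
rewrite -(ler_pXn2r (n := 2)) ?nnegrE ?normc_ge0 // sqr_normcE.
by rewrite real_normK ?num_real // lerDl sqr_ge0.
Qed.

Lemma normcIm z : `|Im z| <= nrm z.
Proof.
rewrite -(ler_pXn2r (n := 2)) ?nnegrE ?normc_ge0 // sqr_normcE.
by rewrite real_normK ?num_real // lerDr sqr_ge0.
Qed.

Lemma normc_leD z : nrm z <= `|Re z| + `|Im z|.
Proof.
rewrite -(ler_pXn2r (n := 2)) ?nnegrE ?normc_ge0 ?addr_ge0 // sqr_normcE.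
rewrite sqrrD !real_normK ?num_real // lerD2r lerDl.
by rewrite mulrn_wge0 // mulr_ge0.
Qed.

Lemma normcR x : nrm x%:C = `|x|.
Proof. by rewrite /= expr0n /= addr0 sqrtr_sqr. Qed.

Lemma normr_normcE z : `|z| = (nrm z)%:C.
Proof. by rewrite normc_def; case: z. Qed.

Lemma normcX z n : nrm (z ^+ n) = nrm z ^+ n.
Proof. by elim: n => [|n IH]; rewrite ?expr0 ?Normc.normc1 // !exprS Normc.normcM IH. Qed.

Lemma normc_gt0 z : (0 < nrm z) = (z != 0).
Proof.
rewrite lt_neqAle normc_ge0 andbT eq_sym; congr negb.
by apply/eqP/eqP => [/Normc.eq0_normc|->] //; rewrite Normc.normc0.
Qed.

Lemma le_normcB z w : nrm (z - w) <= nrm z + nrm w.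
Proof. by apply: le_trans (le_normcD _ _) _; rewrite normcN. Qed.

Lemma ReD z w : Re (z + w) = Re z + Re w. Proof. by case: z w => ? ? [? ?]. Qed.
Lemma ImD z w : Im (z + w) = Im z + Im w. Proof. by case: z w => ? ? [? ?]. Qed.
Lemma ReN z : Re (- z) = - Re z. Proof. by case: z. Qed.
Lemma ImN z : Im (- z) = - Im z. Proof. by case: z. Qed.
Lemma ReM z w : Re (z * w) = Re z * Re w - Im z * Im w.
Proof. by case: z w => ? ? [? ?]. Qed.
Lemma ImM z w : Im (z * w) = Re z * Im w + Im z * Re w.
Proof. by case: z w => ? ? [? ?]. Qed.
Lemma ReZl x z : Re (x%:C * z) = x * Re z.
Proof. by rewrite ReM /= mul0r subr0. Qed.
Lemma ImZl x z : Im (x%:C * z) = x * Im z.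
Proof. by rewrite ImM /= mul0r addr0. Qed.
Lemma ReZ x z : Re (z * x%:C) = Re z * x.
Proof. by rewrite ReM /= mulr0 subr0. Qed.
Lemma ImZ x z : Im (z * x%:C) = Im z * x.
Proof. by rewrite ImM /= mulr0 add0r. Qed.

Lemma expCD z w : expC (z + w) = expC z * expC w.
Proof.
case: z w => a b [c d]; rewrite /expC /= expRD cosD sinD.
by apply/eqP; rewrite eq_complex; simpc => /=; apply/andP; split; apply/eqP; ring.
Qed.

Lemma expC_real x : expC x%:C = (expR x)%:C.
Proof. by rewrite /expC /= cos0 sin0 mulr1. Qed.

Lemma expC0 : expC 0 = 1 :> R[i].
Proof. by rewrite (expC_real 0) expR0. Qed.

Lemma normc_expC z : nrm (expC z) = expR (Re z).
Proof.
rewrite /expC Normc.normcM normcR ger0_norm ?expR_ge0 //=.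
by rewrite cos2Dsin2 sqrtr1 mulr1.
Qed.

Lemma expC_neq0 z : expC z != 0.
Proof. by rewrite -normc_gt0 normc_expC expR_gt0. Qed.

Lemma expCN z : expC (- z) = (expC z)^-1.
Proof.
by apply: (mulfI (expC_neq0 z)); rewrite -expCD subrr expC0 divff // expC_neq0.
Qed.

(** Both bounds come from [1 + t <= expR t] at [t = x] and at [t = - x]; the latter, multiplied by
    [expR x], reads [expR x - 1 <= x * expR x]. *)
Lemma expR_abs_bounds x :
  `|expR x - 1| <= `|x| * expR `|x| /\
  `|expR x - 1 - x| <= x ^+ 2 * expR `|x|.
Proof.
have h1 := expR_ge1Dx x; have h2 := expR_ge1Dx (- x).
have hp := expR_gt0 x; have hq := expR_gt0 (- x).
have pq : expR x * expR (- x) = 1 by rewrite expRN divff // gt_eqF.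
have E1 : expR x - 1 <= x * expR x by nra.
have e1 : 1 <= expR `|x| by rewrite -expR0 ler_expR.
have [x0|x0] := lerP 0 x.
  rewrite (ger0_norm x0) in e1 *.
  split; rewrite ger0_norm; [nra|nra|nra|nra].
have ex1 : expR x <= 1 by rewrite -expR0 ler_expR ltW.
rewrite (ltr0_norm x0) in e1 *; split.
  by rewrite ler0_norm; nra.
rewrite ger0_norm; last nra.
have : expR x - 1 - x <= x ^+ 2 by nra.
move=> H; apply: le_trans H _; rewrite ler_peMr ?sqr_ge0 //.
Qed.

Lemma MVT_norm_le (f df : R -> R) (M y : R) : 0 <= y ->
  (forall x, is_derive x 1 f (df x)) ->
  (forall x, 0 <= x <= y -> `|df x| <= M) -> `|f y - f 0| <= M * y.
Proof.
move=> y0 Df HM.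
have [|c] := MVT_segment y0 (fun x _ => Df x).
  by apply: continuous_subspaceT => x; apply/differentiable_continuous/derivable1_diffP.
rewrite in_itv/= => c0 ->.
by rewrite subr0 normrM (ger0_norm y0) ler_wpM2r // HM.
Qed.

(** The mean value inequality is used twice: derivatives bounded by 1 give linear bounds for [sin x]
    and [cos x - 1], and these bound the derivatives of the two functions in question. *)
Lemma cos_sin_bounds y : `|cos y - 1| <= y ^+ 2 /\ `|sin y - y| <= y ^+ 2.
Proof.
wlog y0 : y / 0 <= y => [H|].
  have [y0|y0] := lerP 0 y; first exact: H.
  have := H (- y); rewrite oppr_ge0 ltW // => /(_ isT).
  by rewrite cosN sinN -opprD normrN sqrrN.
have sinle x : 0 <= x -> `|sin x| <= x.
  move=> x0; have := @MVT_norm_le sin cos 1 x x0 _ (fun x _ => cos_max x).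
  by rewrite sin0 subr0 mul1r; apply.
have cosle x : 0 <= x -> `|cos x - 1| <= x.
  move=> x0; have := @MVT_norm_le cos (fun x => - sin x) 1 x x0.
  by rewrite cos0 mul1r; apply => // z _; rewrite normrN sin_max.
split.
  have := @MVT_norm_le cos (fun x => - sin x) y y y0; rewrite cos0 -expr2; apply.
  move=> x /andP[x0 xy]; rewrite normrN (le_trans (sinle _ _)) //.
have := @MVT_norm_le (fun x => sin x - x) (fun x => cos x - 1) y y y0.
rewrite sin0 !subr0 -expr2; apply => x /andP[x0 xy].
by rewrite (le_trans (cosle _ _)).
Qed.

(** The real part contributes [x^2 + y^2], the imaginary part [y^2 + |x| |y|]; together they are at
    most three times [|z|^2]. *)
Lemma expC_taylor2 z : nrm (expC z - 1 - z) <= 3 * nrm z ^+ 2 * expR (nrm z).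
Proof.
case: z => x y; set z := x +i* y.
have xz : `|x| <= nrm z := normcRe z.
have yz : `|y| <= nrm z := normcIm z.
have nz : nrm z ^+ 2 = x ^+ 2 + y ^+ 2 := sqr_normcE z.
have n0 := normc_ge0 z.
apply: le_trans (normc_leD _) _.
rewrite /expC !ReD !ImD !ReN !ImN ReZl ImZl /= subr0.
have [h1 h2] := expR_abs_bounds x.
have [h3 h4] := cos_sin_bounds y.
have e0 := expR_gt0 x.
have ex : expR x <= expR (nrm z) by rewrite ler_expR (le_trans _ xz) // ler_norm.
have eax : expR `|x| <= expR (nrm z) by rewrite ler_expR.
have eax0 := expR_gt0 `|x|.
have B1 : `|expR x * cos y - 1 - x| <= (x ^+ 2 + y ^+ 2) * expR (nrm z).
  rewrite (_ : _ - x = (expR x - 1 - x) + expR x * (cos y - 1)); last by ring.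
  apply: le_trans (ler_normD _ _) _; rewrite mulrDl lerD //.
    by apply: le_trans h2 _; rewrite ler_wpM2l // sqr_ge0.
  rewrite normrM (gtr0_norm e0) mulrC ler_pM //; exact: ltW.
have B2 : `|expR x * sin y - y| <= (y ^+ 2 + `|x| * `|y|) * expR (nrm z).
  rewrite (_ : _ - y = expR x * (sin y - y) + (expR x - 1) * y); last by ring.
  apply: le_trans (ler_normD _ _) _; rewrite [leRHS]mulrDl lerD //.
    rewrite normrM (gtr0_norm e0) mulrC ler_pM //; exact: ltW.
  rewrite normrM mulrAC ler_wpM2r //.
  by apply: le_trans h1 _; rewrite ler_wpM2l.
apply: le_trans (lerD B1 B2) _; rewrite -mulrDl ler_wpM2r ?expR_ge0 //.
have : `|x| * `|y| <= nrm z ^+ 2 by rewrite expr2 ler_pM.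
have : y ^+ 2 <= nrm z ^+ 2 by rewrite nz lerDr sqr_ge0.
rewrite nz; move: (`|x| * _) => p; lra.
Qed.

(** The constant terms of the two exponentials cancel, so the error is, up to a unit factor, half
    the difference of the exponential remainders at [iz] and [-iz]. *)
Lemma sinC_taylor z : nrm (sinC z - z) <= 3 * nrm z ^+ 2 * expR (nrm z).
Proof.
have ni : nrm ('i%C : R[i]) = 1 by rewrite /= expr0n /= add0r expr1n sqrtr1.
have i0 : 'i%C != 0 :> R[i] by rewrite -normc_gt0 ni.
have -> : sinC z - z = ((expC ('i%C * z) - 1 - 'i%C * z)
    - (expC (- ('i%C * z)) - 1 - - ('i%C * z))) / (2 * 'i%C).
  by rewrite /sinC; field.
rewrite Normc.normcM Normc.normcV Normc.normcM ni mulr1.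
rewrite (_ : 2 = (2 : R)%:C); last by rewrite rmorph_nat.
rewrite normcR ger0_norm // ler_pdivrMr //.
apply: le_trans (le_normcB _ _) _.
have := expC_taylor2 ('i%C * z); have := expC_taylor2 (- ('i%C * z)).
rewrite normcN Normc.normcM ni mul1r; lra.
Qed.

Lemma sinhC_taylor z : nrm (sinhC z - z) <= 3 * nrm z ^+ 2 * expR (nrm z).
Proof.
have -> : sinhC z - z = ((expC z - 1 - z) - (expC (- z) - 1 - - z)) / 2.
  by rewrite /sinhC; field.
rewrite Normc.normcM Normc.normcV.
rewrite (_ : 2 = (2 : R)%:C); last by rewrite rmorph_nat.
rewrite normcR ger0_norm // ler_pdivrMr //.
apply: le_trans (le_normcB _ _) _.
have := expC_taylor2 z; have := expC_taylor2 (- z).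
rewrite normcN; lra.
Qed.

(** One factor [|z|] is kept, since the kernels must vanish linearly in both [u] and [v]; the other
    factor of [|z|^2] is absorbed by a second exponential. *)
Lemma normc_le_taylor z w :
  nrm (w - z) <= 3 * nrm z ^+ 2 * expR (nrm z) ->
  nrm w <= 4 * nrm z * expR (2 * nrm z).
Proof.
have n0 := normc_ge0 z; have := expR_ge1Dx (nrm z).
rewrite (_ : 2 * nrm z = nrm z + nrm z) ?expRD; last by ring.
set e := expR _ => e1 H.
have : nrm w <= nrm (w - z) + nrm z by rewrite -{1}(subrK z w) le_normcD.
move=> {}H'; apply: le_trans H' _; apply: le_trans (lerD H (lexx _)) _.
have : nrm z ^+ 2 * e <= nrm z * (e * e) by rewrite expr2 -mulrA ler_wpM2l // ler_wpM2r; lra.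
have : nrm z * 1 <= nrm z * (e * e) by rewrite ler_wpM2l //; nra.
lra.
Qed.

Definition normc_sinC_le z := normc_le_taylor (sinC_taylor z).
Definition normc_sinhC_le z := normc_le_taylor (sinhC_taylor z).

(** The argument of a positive real is [acos 1 = 0]. Every power below has such a base, hence is an
    exponential of a real logarithm times the exponent. *)
Lemma powC_real t z : 0 < t -> powC t%:C z = expC (z * (ln t)%:C).
Proof.
move=> t0; rewrite /powC (_ : (t%:C == 0) = false); last first.
  by apply/negbTE; rewrite eq_complex /= eqxx andbT gt_eqF.
congr expC; congr (_ * _); rewrite /logC /argC normcR gtr0_norm //=.
by rewrite ltxx divff ?gt_eqF // acos1.
Qed.

End ComplexExp.

(** * Complex-valued integrals *)

Section ComplexMeasurable.
Context d (T : measurableType d) (R : realType).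
Implicit Types (D : set T) (f g : T -> R[i]) (h : T -> R).
Local Notation nrm := Normc.normc.
Local Notation Re := complex.Re.
Local Notation Im := complex.Im.

Definition measurable_funC D f : Prop :=
  measurable_fun D (fun x => Re (f x)) /\ measurable_fun D (fun x => Im (f x)).

Lemma measurable_funC_real D h :
  measurable_fun D h -> measurable_funC D (fun x => (h x)%:C).
Proof. by move=> mh; split => //=; exact: measurable_cst. Qed.

Lemma measurable_funC_cst D (z : R[i]) : measurable_funC D (fun=> z).
Proof. by split; exact: measurable_cst. Qed.

Lemma measurable_funCD D f g : measurable_funC D f -> measurable_funC D g ->
  measurable_funC D (fun x => f x + g x).
Proof.
move=> [rf jf] [rg jg]; split.
- by under eq_fun do rewrite ReD; exact: measurable_funD.
- by under eq_fun do rewrite ImD; exact: measurable_funD.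
Qed.

Lemma measurable_funCN D f : measurable_funC D f -> measurable_funC D (fun x => - f x).
Proof.
move=> [rf jf]; split.
- by under eq_fun do rewrite ReN; exact: measurableT_comp.
- by under eq_fun do rewrite ImN; exact: measurableT_comp.
Qed.

Lemma measurable_funCM D f g : measurable_funC D f -> measurable_funC D g ->
  measurable_funC D (fun x => f x * g x).
Proof.
move=> [rf jf] [rg jg]; split.
- by under eq_fun do rewrite ReM; apply: measurable_funB; exact: measurable_funM.
- by under eq_fun do rewrite ImM; apply: measurable_funD; exact: measurable_funM.
Qed.

Lemma measurable_funC_exp D f :
  measurable_funC D f -> measurable_funC D (fun x => expC (f x)).
Proof.
move=> [rf jf]; apply: measurable_funCM.
  by apply: measurable_funC_real; exact: measurableT_comp.
split => /=; apply: measurableT_comp => //.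
  by apply: continuous_measurable_fun; exact: continuous_cos.
by apply: continuous_measurable_fun; exact: continuous_sin.
Qed.

Lemma measurable_funC_sinC D f :
  measurable_funC D f -> measurable_funC D (fun x => sinC (f x)).
Proof.
move=> mf; rewrite /sinC; apply: measurable_funCM; last exact: measurable_funC_cst.
have mif : measurable_funC D (fun x => 'i%C * f x).
  by apply: measurable_funCM => //; exact: measurable_funC_cst.
apply: measurable_funCD; first exact: measurable_funC_exp.
by apply/measurable_funCN/measurable_funC_exp/measurable_funCN.
Qed.

Lemma measurable_funC_sinhC D f :
  measurable_funC D f -> measurable_funC D (fun x => sinhC (f x)).
Proof.
move=> mf; rewrite /sinhC; apply: measurable_funCM; last exact: measurable_funC_cst.
apply: measurable_funCD; first exact: measurable_funC_exp.
by apply/measurable_funCN/measurable_funC_exp/measurable_funCN.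
Qed.

End ComplexMeasurable.

Section ComplexIntegration.
Context d (T : measurableType d) (R : realType).
Variables (mu : {measure set T -> \bar R}) (D : set T).
Hypothesis mD : measurable D.
Implicit Types (f g : T -> R[i]).
Local Notation nrm := Normc.normc.
Local Notation Re := complex.Re.
Local Notation Im := complex.Im.

Lemma eq_integrableC f g : {in D, f =1 g} -> integrableC mu D f -> integrableC mu D g.
Proof.
move=> fg [h1 h2]; split.
- by apply: eq_integrable h1 => // x xD; rewrite fg.
- by apply: eq_integrable h2 => // x xD; rewrite fg.
Qed.

Lemma eq_integralC f g : {in D, f =1 g} -> integralC mu D f = integralC mu D g.
Proof.
by move=> fg; congr (_ +i* _); apply: eq_Rintegral => x xD; rewrite fg.
Qed.

Lemma integralCD f g : integrableC mu D f -> integrableC mu D g ->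
  integralC mu D (fun x => f x + g x) = integralC mu D f + integralC mu D g.
Proof.
move=> [f1 f2] [g1 g2]; apply/eqP; rewrite eq_complex /=.
rewrite -!RintegralD //; apply/andP; split; apply/eqP; apply: eq_Rintegral => x _.
  by rewrite ReD.
by rewrite ImD.
Qed.

Lemma integralCZ (z : R[i]) f : integrableC mu D f ->
  integralC mu D (fun x => z * f x) = z * integralC mu D f.
Proof.
case: z => a b [f1 f2]; apply/eqP; rewrite eq_complex ReM ImM /=.
have i1 c : mu.-integrable D (EFin \o (fun x => c * Re (f x))).
  by under [X in integrable _ _ X]eq_fun do rewrite /comp EFinM; exact: integrableZl.
have i2 c : mu.-integrable D (EFin \o (fun x => c * Im (f x))).
  by under [X in integrable _ _ X]eq_fun do rewrite /comp EFinM; exact: integrableZl.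
rewrite -!RintegralZl // -RintegralB // -RintegralD //.
by apply/andP; split; apply/eqP; apply: eq_Rintegral => x _; rewrite ?ReM ?ImM.
Qed.

Lemma integrableCZ (z : R[i]) f : integrableC mu D f -> integrableC mu D (fun x => z * f x).
Proof.
case: z => a b [f1 f2]; split.
  have := integrableB mD (integrableZl mD a f1) (integrableZl mD b f2).
  by apply: eq_integrable => // x _; rewrite ReM.
have := integrableD mD (integrableZl mD a f2) (integrableZl mD b f1).
by apply: eq_integrable => // x _; rewrite ImM.
Qed.

Lemma integrableCD f g : integrableC mu D f -> integrableC mu D g ->
  integrableC mu D (fun x => f x + g x).
Proof.
move=> [f1 f2] [g1 g2]; split.
- by apply: eq_integrable (integrableD mD f1 g1) => // x _; rewrite ReD.
- by apply: eq_integrable (integrableD mD f2 g2) => // x _; rewrite ImD.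
Qed.

Variables (E : T -> R).
Hypothesis iE : mu.-integrable D (EFin \o E).

Lemma dominated_integrableC f c : measurable_funC D f ->
  (forall x, D x -> nrm (f x) <= c * E x) -> integrableC mu D f.
Proof.
move=> [m1 m2] fE.
have icE : mu.-integrable D (fun x => (c * E x)%:E).
  by under eq_fun do rewrite EFinM; exact: integrableZl.
split; apply: le_integrable icE => //; try exact/measurable_EFinP.
- move=> x xD; rewrite /= lee_fin (le_trans (normcRe _)) // (le_trans (fE _ xD)) //.
  exact: ler_norm.
- move=> x xD; rewrite /= lee_fin (le_trans (normcIm _)) // (le_trans (fE _ xD)) //.
  exact: ler_norm.
Qed.

(** The factor 2 comes from estimating the real and imaginary parts separately. *)
Lemma normc_integralC_le f c : measurable_funC D f ->
  (forall x, D x -> nrm (f x) <= c * E x) ->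
  nrm (integralC mu D f) <= c * (2 * \int[mu]_(x in D) E x)%R.
Proof.
move=> mf fE; have [i1 i2] := dominated_integrableC mf fE.
have icE : mu.-integrable D (EFin \o (fun x => c * E x)).
  by under [X in integrable _ _ X]eq_fun do rewrite /comp EFinM; exact: integrableZl.
apply: le_trans (normc_leD _) _ => /=.
have -> : c * (2 * \int[mu]_(x in D) E x) =
  \int[mu]_(x in D) (c * E x) + \int[mu]_(x in D) (c * E x).
  by rewrite RintegralZl //; ring.
apply: lerD.
- apply: le_trans (le_normr_Rintegral _ _) _ => //; apply: le_Rintegral => //.
    exact: integrable_norm i1.
  by move=> x xD; rewrite (le_trans (normcRe _)) // fE.
- apply: le_trans (le_normr_Rintegral _ _) _ => //; apply: le_Rintegral => //.
    exact: integrable_norm i2.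
  by move=> x xD; rewrite (le_trans (normcIm _)) // fE.
Qed.

End ComplexIntegration.

(** * Limits and differentiability of complex series *)

Section ComplexLimits.
Context {R : realType}.
Local Notation nrm := Normc.normc.
Local Notation Re := complex.Re.
Local Notation Im := complex.Im.
Local Notation C := (R[i]^o).

(** In [R[i]] the radii of balls are complex, but [0 < e] forces [e] to be real, so real radii
    suffice. *)
Lemma cvg_normcP (T : Type) (F : set_system T) (FF : Filter F) (f : T -> C) (l : C) :
  (forall e : R, 0 < e -> \forall x \near F, nrm (l - f x) < e) <-> f @ F --> l.
Proof.
split=> [H|/cvgrPdist_lt H e e0].
  apply/cvgrPdist_lt => -[e e'] /=; rewrite ltcE /= => /andP[/eqP -> e0].
  by apply: filterS (H _ e0) => x xe; rewrite [X in X < _]normr_normcE ltcR.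
have := H e%:C; rewrite ltcR => /(_ e0).
by apply: filterS => x; rewrite [X in X < _]normr_normcE ltcR.
Qed.

Lemma cvg_ReIm (u : nat -> C) (a b : R) :
  (fun n => Re (u n)) @ \oo --> a -> (fun n => Im (u n)) @ \oo --> b ->
  u @ \oo --> (a +i* b : C).
Proof.
move=> /cvgrPdist_lt ua /cvgrPdist_lt ub; apply/cvg_normcP => e e0.
have e2 : 0 < e / 2 by rewrite divr_gt0.
near=> n; apply: le_lt_trans (normc_leD _) _.
rewrite ReD ImD ReN ImN /= [ltRHS]splitr ltrD //.
  by near: n; exact: ua.
by near: n; exact: ub.
Unshelve. all: by end_near. Qed.

Lemma normc_lim_le (u : nat -> C) (l : C) (B : R) :
  u @ \oo --> l -> (forall n, nrm (u n) <= B) -> nrm l <= B.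
Proof.
move=> /cvg_normcP ul uB; apply/ler_addgt0Pr => e e0.
have [n _ /(_ n (leqnn n)) /= H] := ul _ e0.
rewrite -(subrK (u n) l) (le_trans (le_normcD _ _)) // addrC lerD //.
exact: ltW.
Qed.

(** After division by [k], the difference quotient is within [M * |k|] of [Df]. *)
Lemma derivable_quad (f : C -> C) (s Df : C) (r M : R) : 0 < r ->
  (forall k : C, nrm k <= r -> nrm (f (k + s) - f s - k * Df) <= M * nrm k ^+ 2) ->
  derivable f s 1.
Proof.
move=> r0 H; apply/cvg_ex; exists Df; apply/cvg_normcP => e e0.
(* [M] may be negative or zero; [M'] is a positive majorant by which one can divide. *)
pose M' := `|M| + 1; have M0 : 0 < M' by rewrite ltr_wpDl.
pose e' := Num.min r (e / M').
have e'0 : 0 < e' by rewrite lt_min r0 divr_gt0.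
rewrite near_withinE; apply/nbhs_ballP; exists (e'%:C) => /=.
  by rewrite ltcR.
move=> k; rewrite -ball_normE /= sub0r normrN normr_normcE ltcR lt_min => /andP[kr ke] k0.
have nk : 0 < nrm k by rewrite normc_gt0.
have := H k (ltW kr).
rewrite [_ *: _](_ : _ = k^-1 * (f (k + s) - f s)); last by rewrite [k *: 1]mulr1.
have -> : Df - k^-1 * (f (k + s) - f s) = - (k^-1 * (f (k + s) - f s - k * Df)).
  by rewrite [in RHS]mulrBr mulKf // opprB.
rewrite normcN Normc.normcM Normc.normcV => {}H.
rewrite mulrC ltr_pdivrMr //.
apply: le_lt_trans H _; rewrite expr2 mulrA ltr_pM2r //.
apply: (@le_lt_trans _ _ (M' * nrm k)); last by rewrite mulrC -ltr_pdivlMr.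
by rewrite ler_wpM2r ?(ltW nk) // (le_trans (ler_norm _)) // lerDl.
Qed.

Lemma derivable_mulC (f g : C -> C) (s : C) :
  derivable f s 1 -> derivable g s 1 -> derivable (fun z => f z * g z : C) s 1.
Proof. by move=> df dg; exact: (@derivableM _ _ f g s 1 df dg). Qed.

Lemma derivable_scaleC (c : C) (g : C -> C) (s : C) :
  derivable g s 1 -> derivable (fun z => c * g z : C) s 1.
Proof. by move=> dg; exact: (@derivableZ _ _ _ g c s 1 dg). Qed.

Lemma derivable_invC (f : C -> C) (s : C) :
  f s != 0 -> derivable f s 1 -> derivable (fun z => (f z)^-1 : C) s 1.
Proof. by move=> f0 df; exact: (@derivableV _ _ f s 1 f0 df). Qed.

(** Both [b n] and [x n + b n] are nonnegative with bounded partial sums, so their series converge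
    by monotonicity; their difference is the series of [x]. *)
Lemma cvgn_sum_dominated (x b : nat -> R) (B : R) :
  (forall n, (0 < n)%N -> `|x n| <= b n) ->
  (forall N, \sum_(1 <= n < N) b n <= B) ->
  cvgn (fun N => \sum_(1 <= n < N) x n).
Proof.
move=> xb bB.
have nd (y : nat -> R) : (forall n, (0 < n)%N -> 0 <= y n) ->
    nondecreasing_seq (fun N => \sum_(1 <= n < N) y n).
  move=> y0; apply/nondecreasing_seqP => -[|n]; first by rewrite !big_geq.
  by rewrite [leRHS]big_nat_recr //= lerDl y0.
have b0 n : (0 < n)%N -> 0 <= b n by move=> /xb; exact: le_trans.
have cb : cvgn (fun N => \sum_(1 <= n < N) b n).
  by apply: nondecreasing_is_cvgn; [exact: nd|exists B => _ [n _ <-]].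
have cxb : cvgn (fun N => \sum_(1 <= n < N) (x n + b n)).
  apply: nondecreasing_is_cvgn.
    by apply: nd => n /xb; rewrite ler_norml; lra.
  exists (B + B) => _ [n _ <-]; rewrite big_split /= lerD //.
  apply: le_trans (bB n); rewrite big_nat [leRHS]big_nat; apply: ler_sum => i /andP[i0 _].
  by rewrite (le_trans (ler_norm _)) // xb.
suff -> : (fun N => \sum_(1 <= n < N) x n) =
    (fun N => \sum_(1 <= n < N) (x n + b n)) - (fun N => \sum_(1 <= n < N) b n).
  exact: is_cvgB.
by apply/funext => N; rewrite !fctE -sumrB; apply: eq_bigr => i _; rewrite addrK.
Qed.

Lemma cvgn_sumC_dominated (x : nat -> C) (b : nat -> R) (B : R) :
  (forall n, (0 < n)%N -> nrm (x n) <= b n) ->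
  (forall N, \sum_(1 <= n < N) b n <= B) ->
  cvgn (fun N => \sum_(1 <= n < N) x n).
Proof.
move=> xb bB.
have rx := @cvgn_sum_dominated (fun n => Re (x n)) b B
  (fun n n0 => le_trans (normcRe _) (xb n n0)) bB.
have ix := @cvgn_sum_dominated (fun n => Im (x n)) b B
  (fun n n0 => le_trans (normcIm _) (xb n n0)) bB.
have rE : (fun N => Re (\sum_(1 <= n < N) x n)) = (fun N => \sum_(1 <= n < N) Re (x n)).
  by apply/funext => N; elim/big_ind2 : _ => // ? ? ? ? <- <-; rewrite ReD.
have iE : (fun N => Im (\sum_(1 <= n < N) x n)) = (fun N => \sum_(1 <= n < N) Im (x n)).
  by apply/funext => N; elim/big_ind2 : _ => // ? ? ? ? <- <-; rewrite ImD.
apply/cvg_ex; eexists; apply: cvg_ReIm; [rewrite rE; exact: rx|rewrite iE; exact: ix].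
Qed.

Lemma normc_sum_le (x : nat -> C) (b : nat -> R) (B : R) :
  (forall n, (0 < n)%N -> nrm (x n) <= b n) ->
  (forall N, \sum_(1 <= n < N) b n <= B) ->
  forall N, nrm (\sum_(1 <= n < N) x n) <= B.
Proof.
move=> xb bB N; apply: le_trans (bB N); rewrite !big_nat.
elim/big_ind2 : _ => [|z y w v zy wv|n /andP[n0 _]]; last exact: xb.
  by rewrite Normc.normc0.
by rewrite (le_trans (le_normcD _ _)) // lerD.
Qed.

Lemma cvg_subZ (k : C) (u w : nat -> C) (a c : C) :
  u @ \oo --> a -> w @ \oo --> c ->
  (fun N => u N - k * w N) @ \oo --> a - k * c.
Proof.
move=> ua wc; have H := cvgZl_tmp (k := k) wc.
exact: (cvgB ua (H _)).
Qed.

Lemma cvg_subB_Z (k : C) (u v w : nat -> C) (a b c : C) :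
  u @ \oo --> a -> v @ \oo --> b -> w @ \oo --> c ->
  (fun N => u N - v N - k * w N) @ \oo --> a - b - k * c.
Proof.
move=> ua vb; apply: cvg_subZ; have H := cvgB ua vb.
exact: (H _).
Qed.

(** Quadratic remainders with summable constants [q n] add up to a quadratic remainder of the sum.
    The bounds [b k] serve only for convergence at [k + s], whereas [q] makes the series of
    derivatives converge as well. *)
Lemma derivable_series (F : nat -> C -> C) (D : nat -> C) (s : C) (r : R)
    (b : C -> nat -> R) (B : C -> R) (q : nat -> R) (Q : R) : 0 < r ->
  (forall k, nrm k <= r -> forall n, (0 < n)%N -> nrm (F n (k + s)) <= b k n) ->
  (forall k, nrm k <= r -> forall N, \sum_(1 <= n < N) b k n <= B k) ->
  (forall n, (0 < n)%N -> nrm (D n) <= q n) ->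
  (forall k, nrm k <= r -> forall n, (0 < n)%N ->
     nrm (F n (k + s) - F n s - k * D n) <= nrm k ^+ 2 * q n) ->
  (forall N, \sum_(1 <= n < N) q n <= Q) ->
  derivable (fun s => limn (fun N => \sum_(1 <= n < N) F n s) : C) s 1.
Proof.
move=> r0 Fb bB Dq Fq qQ.
pose S := fun s => limn (fun N => \sum_(1 <= n < N) F n s) : C.
have cF k : nrm k <= r -> (fun N => \sum_(1 <= n < N) F n (k + s)) @ \oo --> S (k + s).
  by move=> kr; exact: (cvgn_sumC_dominated (Fb k kr) (bB k kr)).
have cF0 : (fun N => \sum_(1 <= n < N) F n s) @ \oo --> S s.
  by have := cF 0; rewrite add0r; apply; rewrite Normc.normc0 ltW.
have cD := cvgn_sumC_dominated Dq qQ.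
apply: (@derivable_quad _ _ (limn (fun N => \sum_(1 <= n < N) D n)) r Q r0) => k kr.
have H := cvg_subB_Z (k := k) (cF k kr) cF0 cD.
apply: (normc_lim_le H) => N; rewrite -sumrB mulr_sumr -sumrB mulrC.
apply: (@normc_sum_le _ (fun n => nrm k ^+ 2 * q n)) => [n n0|M]; first exact: Fq.
by rewrite -mulr_sumr ler_wpM2l // sqr_ge0.
Qed.

End ComplexLimits.

(** * Mellin-type integrals *)

Section MellinTransform.
Context d (T : measurableType d) (R : realType).
Variables (mu : {measure set T -> \bar R}) (D : set T).
Hypothesis mD : measurable D.
Variables (E : T -> R) (h : T -> R[i]) (L : T -> R) (c : R -> R) (s0 : R).
Hypothesis iE : mu.-integrable D (EFin \o E).
Hypothesis mh : measurable_funC D h.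
Hypothesis mL : measurable_fun D L.
Local Notation nrm := Normc.normc.
Local Notation Re := complex.Re.
Local Notation Im := complex.Im.
Hypothesis hE : forall y x, s0 < y -> D x -> nrm (h x) * expR (y * L x) <= c y * E x.

Definition mellin_integrand s x := h x * expC (s * (L x)%:C).
Definition mellin s := integralC mu D (mellin_integrand s).
Definition mellin_deriv s :=
  integralC mu D (fun x => h x * (L x)%:C * expC (s * (L x)%:C)).
Local Notation K := (2 * \int[mu]_(x in D) E x)%R.

Lemma measurable_mellin_integrand s : measurable_funC D (mellin_integrand s).
Proof.
apply: measurable_funCM => //; apply: measurable_funC_exp; apply: measurable_funCM.
  exact: measurable_funC_cst.
exact: measurable_funC_real.
Qed.

Lemma mellin_integrand_le s : s0 < Re s ->
  forall x, D x -> nrm (mellin_integrand s x) <= c (Re s) * E x.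
Proof.
by move=> ss x xD; rewrite Normc.normcM normc_expC ReZ hE.
Qed.

Lemma mellin_integrable s : s0 < Re s -> integrableC mu D (mellin_integrand s).
Proof.
move=> ss; apply: (dominated_integrableC mD iE _ (mellin_integrand_le ss)).
exact: measurable_mellin_integrand.
Qed.

Lemma normc_mellin_le s : s0 < Re s -> nrm (mellin s) <= c (Re s) * K.
Proof.
move=> ss; apply: (normc_integralC_le mD iE _ (mellin_integrand_le ss)).
exact: measurable_mellin_integrand.
Qed.

(** Growth in [|l|] is traded for a shift of the exponent [y] by [e] in both directions, where the
    domination hypothesis [hE] applies again. *)
Let expR_shift (y e l : R) : expR (y * l) * expR (e * `|l|) <=
  expR ((y + e) * l) + expR ((y - e) * l).
Proof.
have [l0|l0] := lerP 0 l.
  by rewrite ?ger0_norm // -expRD mulrDl lerDl expR_ge0.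
by rewrite ltr0_norm // -expRD mulrN -mulrBl lerDr expR_ge0.
Qed.

Let mellin_weight s e x : 0 < e -> s0 < Re s - e -> D x ->
  nrm (h x) * expR (Re s * L x) * expR (e * `|L x|) <=
  (c (Re s + e) + c (Re s - e)) * E x.
Proof.
move=> e0 se xD; rewrite -mulrA.
apply: le_trans (ler_wpM2l (normc_ge0 _) (expR_shift _ _ _)) _.
by rewrite [leLHS]mulrDr [leRHS]mulrDl lerD // hE //; lra.
Qed.

Let measurable_mellin_deriv s :
  measurable_funC D (fun x => h x * (L x)%:C * expC (s * (L x)%:C)).
Proof.
apply: measurable_funCM.
  by apply: measurable_funCM => //; exact: measurable_funC_real.
by apply: measurable_funC_exp; apply: measurable_funCM;
  [exact: measurable_funC_cst|exact: measurable_funC_real].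
Qed.

(** The extra factor [|L|] is paid by [e |L| <= expR (e |L|)], which costs [e^-1]. *)
Let mellin_deriv_integrand_le s e : 0 < e -> s0 < Re s - e -> forall x, D x ->
  nrm (h x * (L x)%:C * expC (s * (L x)%:C)) <=
  e^-1 * (c (Re s + e) + c (Re s - e)) * E x.
Proof.
move=> e0 se x xD; rewrite Normc.normcM normc_expC Normc.normcM ReZ normcR.
rewrite -[leRHS]mulrA ler_pdivlMl //; apply: le_trans (mellin_weight e0 se xD).
rewrite [leLHS](_ : _ = nrm (h x) * expR (Re s * L x) * (e * `|L x|)); last by ring.
rewrite ler_wpM2l ?mulr_ge0 ?normc_ge0 ?expR_ge0 //.
by apply: le_trans (expR_ge1Dx _); rewrite lerDr.
Qed.

Lemma normc_mellin_deriv_le s e : 0 < e -> s0 < Re s - e ->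
  nrm (mellin_deriv s) <= e^-1 * (c (Re s + e) + c (Re s - e)) * K.
Proof.
move=> e0 se.
exact: (normc_integralC_le mD iE (measurable_mellin_deriv s) (mellin_deriv_integrand_le e0 se)).
Qed.

Let sqr_le_expR (t : R) : 0 <= t -> t ^+ 2 <= 4 * expR t.
Proof.
move=> t0; have := expR_ge1Dx (t / 2) => h1.
rewrite (_ : expR t = expR (t / 2) ^+ 2); last by rewrite expr2 -expRD -splitr.
have : 0 <= t / 2 by rewrite divr_ge0.
set u := expR _ in h1 *; nra.
Qed.

(** The remainder under the integral is at most [3 |k|^2 L^2 expR (|k| |L|)] times the modulus of
    the integrand. Half of [expR (e |L|)] absorbs the last factor since [|k| <= e / 2]; the other
    half absorbs [L^2] at the cost [16 e^-2], whence [48 = 3 * 16]. *)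
Lemma mellin_taylor s k e : 0 < e -> s0 < Re s - e -> nrm k <= e / 2 ->
  nrm (mellin (k + s) - mellin s - k * mellin_deriv s) <=
  nrm k ^+ 2 * (48 * e ^- 2 * (c (Re s + e) + c (Re s - e)) * K).
Proof.
move=> e0 se ke.
have kR : - (e / 2) <= Re k.
  by have := le_trans (normcRe k) ke; rewrite ler_norml => /andP[].
have i1 : integrableC mu D (mellin_integrand (k + s)).
  by apply: mellin_integrable; rewrite ReD; lra.
have i2 : integrableC mu D (mellin_integrand s) by apply: mellin_integrable; lra.
have i3 := dominated_integrableC mD iE (measurable_mellin_deriv s)
  (mellin_deriv_integrand_le e0 se).
rewrite /mellin /mellin_deriv.
rewrite -mulN1r -(integralCZ mD) // -(integralCD mD) //; last exact: integrableCZ.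
rewrite -mulNr -(integralCZ mD) // -(integralCD mD); first last.
- exact: integrableCZ.
- by apply: integrableCD => //; exact: integrableCZ.
rewrite [leRHS]mulrA.
have mtot : measurable_funC D (fun x => mellin_integrand (k + s) x +
   -1 * mellin_integrand s x + - k * (h x * (L x)%:C * expC (s * (L x)%:C))).
  apply: measurable_funCD; first apply: measurable_funCD.
  - exact: measurable_mellin_integrand.
  - by apply: measurable_funCM; [exact: measurable_funC_cst|exact: measurable_mellin_integrand].
  - by apply: measurable_funCM; [exact: measurable_funC_cst|exact: measurable_mellin_deriv].
apply: (normc_integralC_le mD iE mtot) => x xD.
rewrite (_ : _ + _ = (h x * expC (s * (L x)%:C)) *
    (expC (k * (L x)%:C) - 1 - k * (L x)%:C)); last first.
  by rewrite /mellin_integrand mulrDl expCD; ring.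
rewrite Normc.normcM [X in X * _]Normc.normcM normc_expC ReZ.
have kn0 := normc_ge0 k.
have W0 : 0 <= nrm (h x) * expR (Re s * L x) by rewrite mulr_ge0 ?normc_ge0 ?expR_ge0.
apply: le_trans (ler_wpM2l W0 (expC_taylor2 _)) _.
rewrite Normc.normcM normcR; set l := `|L x|; set W := _ * expR _ in W0 *.
have l0 : 0 <= l by exact: normr_ge0.
have H1 : l ^+ 2 * expR (nrm k * l) <= 16 * e ^- 2 * expR (e * l).
  have := @sqr_le_expR (e / 2 * l) (mulr_ge0 (divr_ge0 (ltW e0) (ler0n _ _)) l0).
  rewrite (_ : expR (e * l) = expR (e / 2 * l) * expR (e / 2 * l)); last first.
    by rewrite -expRD -mulrDl -splitr.
  have : expR (nrm k * l) <= expR (e / 2 * l) by rewrite ler_expR ler_wpM2r.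
  move=> H2 H3; rewrite mulrA ler_pM ?sqr_ge0 ?expR_ge0 //.
  rewrite -mulrA mulrCA ler_pdivlMl ?exprn_gt0 //.
  by move: H3; rewrite (_ : (e / 2 * l) ^+ 2 = e ^+ 2 * l ^+ 2 / 4); [lra|field].
have := mellin_weight e0 se xD; rewrite -/W -/l => H4.
have k2 : 0 <= nrm k ^+ 2 by rewrite sqr_ge0.
have -> : W * (3 * (nrm k * l) ^+ 2 * expR (nrm k * l)) =
  nrm k ^+ 2 * (3 * (W * (l ^+ 2 * expR (nrm k * l)))) by ring.
rewrite -(mulrA (nrm k ^+ 2)) ler_wpM2l //.
have -> : 48 * e ^- 2 * (c (Re s + e) + c (Re s - e)) * E x =
  3 * (16 * e ^- 2 * ((c (Re s + e) + c (Re s - e)) * E x)) by ring.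
rewrite ler_wpM2l //; apply: le_trans (ler_wpM2l W0 H1) _.
by rewrite mulrCA ler_wpM2l // mulr_ge0 // invr_ge0 exprn_ge0 // ltW.
Qed.

End MellinTransform.

(** * The Gamma function *)

Section HalfLine.
Context {R : realType}.
Local Notation mu := (@lebesgue_measure R).
Implicit Types (p t b M : R).

Lemma cvg_expRN_y b : 0 < b -> expR (- (b * t)) @[t --> +oo] --> (0 : R).
Proof.
move=> b0; apply/cvgrPdist_lt => e e0; near=> t.
rewrite sub0r normrN gtr0_norm ?expR_gt0 // -[ltRHS]lnK ?posrE // ltr_expR.
rewrite ltrNl mulrC -ltr_pdivrMr //; near: t; apply: nbhs_pinfty_gt; exact: num_real.
Unshelve. all: by end_near. Qed.

Lemma is_derive_expRN b t : b != 0 ->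
  is_derive t 1 (fun t => - (b^-1 * expR (- (b * t)))) (expR (- (b * t))).
Proof.
move=> b0; apply: is_derive_eq.
by rewrite /GRing.scale /=; field.
Qed.

Lemma continuous_expRN b : continuous (fun t => expR (- (b * t))).
Proof.
move=> t; apply: (@continuous_comp _ _ _ (fun t => - (b * t)) expR); last exact: continuous_expR.
by apply: cvgN; apply: cvgMl_tmp; exact: cvg_id.
Qed.

Lemma integral_expRN b : 0 < b ->
  (\int[mu]_(t in `[0%R, +oo[) (expR (- (b * t)))%:E = b^-1%:E)%E.
Proof.
move=> b0; have D t := is_derive_expRN t (lt0r_neq0 b0).
rewrite (@ge0_continuous_FTC2y _ _ (fun t => - (b^-1 * expR (- (b * t)))) 0 0) //.
- by rewrite mulr0 oppr0 expR0 mulr1 EFinN oppeK add0e.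
- by apply: continuous_subspaceT; exact: continuous_expRN.
- rewrite -[0]oppr0 -[in X in _ --> X](mulr0 b^-1).
  by apply: cvgN; apply: cvgMl_tmp; exact: cvg_expRN_y.
- by apply: cvg_at_right_filter; apply: cvgN; apply: cvgMl_tmp; exact: continuous_expRN.
- by move=> x _; rewrite derive1E; exact: derive_val.
Qed.

Lemma integrable_expRN b : 0 < b ->
  mu.-integrable `]0, +oo[ (EFin \o (fun t => expR (- (b * t)))).
Proof.
move=> b0; suff : mu.-integrable `[0, +oo[ (EFin \o (fun t => expR (- (b * t)))).
  by apply: integrableS => //; apply: subset_itvr; rewrite bnd_simp.
apply/integrableP; split.
  have mf := continuous_measurable_fun (@continuous_expRN b).
  by apply/measurable_EFinP; exact: measurable_funTS mf.
rewrite [X in (X < _)%E](_ : _ = b^-1%:E) ?ltry // -integral_expRN //.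
by apply: eq_integral => t _; rewrite /= gtr0_norm ?expR_gt0.
Qed.

Lemma Rintegral_expRN b : 0 < b ->
  \int[mu]_(t in `]0, +oo[) expR (- (b * t)) = b^-1.
Proof.
move=> b0; rewrite Rintegral_itv_obnd_cbnd; last exact: integrable_expRN.
by rewrite /Rintegral integral_expRN.
Qed.

(* Adding a multiple of an exponential makes the integrand nonnegative, the case
   covered by [ge0_continuous_FTC2y]. *)
Lemma Rintegral_FTC2y_dominated (f F : R -> R) b M : 0 < b ->
  {within `[0, +oo[, continuous f} ->
  (forall t, 0 <= t -> `|f t| <= M * expR (- (b * t))) ->
  F x @[x --> +oo] --> (0 : R) -> F x @[x --> 0^'+] --> F 0 ->
  (forall t, 0 < t -> is_derive t 1 F (f t)) ->
  mu.-integrable `]0, +oo[ (EFin \o f) /\ \int[mu]_(t in `]0, +oo[) f t = - F 0.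
Proof.
move=> b0 cf fM Foo F0 DF.
have iM : mu.-integrable `]0, +oo[ (EFin \o (fun t => M * expR (- (b * t)))).
  by under [X in integrable _ _ X]eq_fun do rewrite /comp EFinM;
    apply: integrableZl => //; exact: integrable_expRN.
have mf : measurable_fun `](0 : R), +oo[ f.
  apply: open_continuous_measurable_fun => //.
  by move: cf => /continuous_within_itvcyP[/in_continuous_mksetP cf _].
have itf : mu.-integrable `]0, +oo[ (EFin \o f).
  apply: le_integrable iM => //; first exact/measurable_EFinP.
  move=> t /=; rewrite in_itv /= andbT => t0; rewrite lee_fin.
  by rewrite (le_trans (fM t (ltW t0))) // ler_norm.
split=> //.
pose G t := F t - M * (b^-1 * expR (- (b * t))).
have DG t : 0 < t -> is_derive t 1 G (f t + M * expR (- (b * t))).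
  move=> t0; have D1 := DF t t0; have D2 := is_derive_expRN t (lt0r_neq0 b0).
  rewrite (_ : G = F + M \*: (fun t => - (b^-1 * expR (- (b * t))))); last first.
    by apply/funext => x; rewrite /G !fctE /= /GRing.scale /= mulrN.
  exact: is_deriveD.
have gE : \int[mu]_(t in `[0, +oo[) (f t + M * expR (- (b * t))) = - G 0.
  rewrite (@Rintegral_ge0_continuous_FTC2y _ _ G 0 0) ?sub0r //.
  - by move=> t t0; have := fM t t0; rewrite ler_norml => /andP[+ _]; rewrite -lerBlDr sub0r.
  - move=> t; apply: cvgD; first exact: cf.
    apply: cvgMl_tmp; have : {within `[0, +oo[, continuous (fun t => expR (- (b * t)))}.
      by apply: continuous_subspaceT; exact: continuous_expRN.
    exact.
  - rewrite [X in _ --> X](_ : _ = 0 - M * (b^-1 * 0)); last by rewrite !mulr0 subr0.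
    by apply: cvgB => //; do 2! apply: cvgMl_tmp; exact: cvg_expRN_y.
  - by move=> t /DG [].
  - apply: cvgB => //; apply: cvg_at_right_filter.
    by do 2! apply: cvgMl_tmp; exact: continuous_expRN.
  - move=> t; rewrite in_itv /= andbT => /DG ?.
    by rewrite derive1E; exact: derive_val.
(* The added exponential has integral [M * b^-1], which is also its contribution to [- G 0], so it
   cancels. *)
move: gE; rewrite -Rintegral_itv_obnd_cbnd; last first.
  by apply: eq_integrable (integrableD _ itf iM).
rewrite RintegralD // RintegralZl //; last exact: integrable_expRN.
rewrite Rintegral_expRN // /G mulr0 oppr0 expR0 mulr1 opprB => /eqP.
by rewrite [X in _ == X]addrC (inj_eq (addIr _)) => /eqP.
Qed.

End HalfLine.

(** * Bounds and exact derivatives for Gamma integrands *)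

Section GammaIntegrals.
Context {R : realType}.
Local Notation mu := (@lebesgue_measure R).
Implicit Types (p t x y a : R).

Lemma ln_le_subr1 t : 0 < t -> ln t <= t - 1.
Proof. by move=> t0; have := expR_ge1Dx (ln t); rewrite lnK ?posrE //; lra. Qed.

(** Up to the factor [p], the constant of the tangent bound for [ln] at [2 (p + 1)], a point whose
    slope gives [p * t / (2 (p + 1)) <= t / 2]. Half of the decay [expR (- t)] thus pays for the
    power [t^p], and the other half stays as an integrable majorant. *)
Definition gamma_cst p := p * (ln (2 * (p + 1)) - 1).

Lemma mul_ln_le p t : 0 <= p -> 0 < t -> p * ln t <= t / 2 + gamma_cst p.
Proof.
move=> p0 t0; have p1 : 0 < 2 * (p + 1) by lra.
have := @ln_le_subr1 (t / (2 * (p + 1))) (divr_gt0 t0 p1).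
rewrite ln_div ?posrE // => H.
have : p * (t / (2 * (p + 1))) <= t / 2.
  rewrite (_ : t / 2 = (p + 1) * (t / (2 * (p + 1)))); last by field; rewrite gt_eqF //; lra.
  by rewrite ler_wpM2r ?divr_ge0 ?(ltW t0) ?(ltW p1) //; lra.
by rewrite /gamma_cst; nra.
Qed.

Lemma expR_gamma_le p t : 0 <= p -> 0 < t ->
  expR (p * ln t - t) <= expR (gamma_cst p) * expR (- (2^-1 * t)).
Proof.
by move=> p0 t0; rewrite -expRD ler_expR; have := mul_ln_le p0 t0; lra.
Qed.

Lemma cvg_at_right0_dominated (g : R -> R) p K : 0 < p ->
  (forall t, 0 < t -> t < 1 -> `|g t| <= K * expR (p * ln t)) ->
  g t @[t --> 0^'+] --> (0 : R).
Proof.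
move=> p0 gK; apply/cvgrPdist_lt => e e0.
pose K' := `|K| + 1; have K0 : 0 < K' by rewrite ltr_wpDl.
near=> t; have t0 : 0 < t by near: t; exact: nbhs_right_gt.
rewrite sub0r normrN; apply: le_lt_trans (gK t t0 _) _.
  by near: t; exact: nbhs_right_lt.
apply: (@le_lt_trans _ _ (K' * expR (p * ln t))).
  by rewrite ler_wpM2r ?expR_ge0 // (le_trans (ler_norm _)) // lerDl.
(* The condition [t^p < e / K'] is solved for [t], with threshold [(e / K')^(1/p)]. *)
rewrite mulrC -ltr_pdivlMr // -[ltRHS]lnK ?posrE ?divr_gt0 // ltr_expR.
rewrite mulrC -ltr_pdivlMr // -ltr_expR lnK ?posrE //.
by near: t; apply: nbhs_right_lt; exact: expR_gt0.
Unshelve. all: by end_near. Qed.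

Lemma cvg_y_dominated (g : R -> R) b K : 0 < b ->
  (forall t, 0 < t -> `|g t| <= K * expR (- (b * t))) ->
  g t @[t --> +oo] --> (0 : R).
Proof.
move=> b0 gK.
have H : K * expR (- (b * t)) @[t --> +oo] --> (0 : R).
  have := @cvgMl_tmp _ _ _ _ _ K _ (cvg_expRN_y b0).
  by rewrite mulr0; apply.
apply/cvgrPdist_lt => e e0; move/cvgrPdist_lt : H => /(_ e e0) H.
near=> t; have t0 : 0 < t by near: t; apply: nbhs_pinfty_gt; exact: num_real.
rewrite sub0r normrN; apply: le_lt_trans (gK t t0) _.
apply: le_lt_trans (ler_norm _) _; rewrite -[X in X < _]normrN -sub0r.
by near: t.
Unshelve. all: by end_near. Qed.

(** This is the real part of [exp(ia) t^(x+iy) exp(-t)]; the phases [0] and [- pi / 2] give the real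
    and imaginary parts of [t^(x+iy) exp(-t)]. *)
Definition gamma_wave x y a t := expR (x * ln t - t) * cos (y * ln t + a).
Definition gamma_wave' x y a t :=
  expR ((x - 1) * ln t - t) * ((x - t) * cos (y * ln t + a) - y * sin (y * ln t + a)).

Lemma is_derive_gamma_wave x y a t : 0 < t ->
  is_derive t 1 (gamma_wave x y a) (gamma_wave' x y a t).
Proof.
move=> t0; have Dln := is_derive1_ln t0; apply: is_derive_eq.
rewrite /gamma_wave' /GRing.scale /=.
rewrite (_ : (x - 1) * ln t - t = (x * ln t - t) - ln t); last by ring.
rewrite (expRD _ (- ln t)) expRN lnK ?posrE //.
by field; rewrite gt_eqF.
Qed.

Lemma continuous_gamma_wave' x y a t : 0 < t -> {for t, continuous (gamma_wave' x y a)}.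
Proof.
move=> t0; have Dln := is_derive1_ln t0.
have : derivable (gamma_wave' x y a) t 1 by apply: ex_derive.
by move/derivable1_diffP/differentiable_continuous.
Qed.

Lemma gamma_wave'_le x y a t : 0 <= x -> 0 < t ->
  `|gamma_wave' x y a t| <= (x + `|y| + t) * expR ((x - 1) * ln t - t).
Proof.
move=> x0 t0; rewrite normrM gtr0_norm ?expR_gt0 // mulrC ler_wpM2r ?expR_ge0 //.
apply: le_trans (ler_normB _ _) _; rewrite !normrM.
have h1 := cos_max (y * ln t + a); have h2 := sin_max (y * ln t + a).
have : `|x - t| <= x + t by rewrite (le_trans (ler_normB _ _)) // !ger0_norm // ltW.
have := normr_ge0 (x - t); have := normr_ge0 y.
nra.
Qed.

(** The integrand is the derivative of a wave that vanishes at both ends of the half-line. The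
    complex and the real functional equations of Gamma both follow from this. *)
Lemma Rintegral_gamma_wave' x y a : 1 < x ->
  mu.-integrable `]0, +oo[ (EFin \o gamma_wave' x y a) /\
  \int[mu]_(t in `]0, +oo[) gamma_wave' x y a t = 0.
Proof.
move=> x1; have x0 : 0 <= x by lra.
(* Extension by zero gives the right limits at 0, where [ln] takes a default value; [1 < x] makes
   [t^(x-1)] tend to 0 there, so [f] is continuous on the closed half-line. *)
pose f t := if 0 < t then gamma_wave' x y a t else 0.
pose F t := if 0 < t then gamma_wave x y a t else 0.
have pos_near t : 0 < t -> \forall u \near t, 0 < u by move=> t0; exact: lt_nbhsr.
have [i1 i2] : mu.-integrable `]0, +oo[ (EFin \o f) /\
    \int[mu]_(t in `]0, +oo[) f t = - F 0.
  (* Of the decay [expR (- t / 2)] left by [expR_gamma_le], one half absorbs the linear factor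
     [x + |y| + t] through [1 + t / 4 <= expR (t / 4)]; the other half gives the rate [4^-1]. *)
  apply: (@Rintegral_FTC2y_dominated _ f F 4^-1
    ((x + `|y| + 4) * expR (gamma_cst (x - 1)))) => //.
  - apply/continuous_within_itvcyP; split.
      move=> t; rewrite in_itv /= andbT => t0.
      have := @continuous_gamma_wave' x y a t t0.
      rewrite /continuous_at {2}/f t0; apply: cvg_trans; apply: near_eq_cvg.
      by near do rewrite /f ifT //; exact: pos_near.
    rewrite {2}/f ltxx; apply: (@cvg_at_right0_dominated _ (x - 1) (x + `|y| + 1)); first lra.
    move=> t t0 t1; rewrite /f t0; apply: le_trans (gamma_wave'_le _ _ x0 t0) _.
    apply: ler_pM; rewrite ?expR_ge0 ?ler_expR //; first by rewrite !addr_ge0 // ltW.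
      by rewrite lerD2l ltW.
    by lra.
  - move=> t t0; rewrite /f; case: ifPn => [{}t0|_]; last first.
      by rewrite normr0 !mulr_ge0 ?expR_ge0 // !addr_ge0.
    apply: le_trans (gamma_wave'_le _ _ x0 t0) _.
    apply: le_trans (ler_wpM2l _ (expR_gamma_le (p := x - 1) _ t0)) _; [|lra|].
      by rewrite !addr_ge0 // ltW.
    rewrite -mulrA mulrCA [leRHS]mulrCA ler_wpM2l ?expR_ge0 //.
    rewrite (_ : - (2^-1 * t) = - (4^-1 * t) - (4^-1 * t)); last by field.
    rewrite expRD mulrCA mulrC ler_wpM2r ?expR_ge0 //.
    rewrite expRN ler_pdivrMr ?expR_gt0 //.
    have := expR_ge1Dx (4^-1 * t); have := normr_ge0 y; have : 0 <= t by exact: ltW.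
    by set u := expR _; nra.
  - apply: (@cvg_y_dominated _ 2^-1 (expR (gamma_cst x))) => // t t0.
    rewrite /F t0 normrM gtr0_norm ?expR_gt0 //.
    apply: le_trans (expR_gamma_le x0 t0).
    by rewrite ler_piMr ?expR_ge0 ?cos_max.
  - rewrite {2}/F ltxx; apply: (@cvg_at_right0_dominated _ x 1); first lra.
    move=> t t0 t1; rewrite /F t0 mul1r normrM gtr0_norm ?expR_gt0 //.
    apply: (@le_trans _ _ (expR (x * ln t - t))); first by rewrite ler_piMr ?expR_ge0 ?cos_max.
    by rewrite ler_expR; lra.
  - move=> t t0; apply: near_eq_is_derive.
      by near=> u; rewrite /F ifT //; near: u; exact: pos_near.
    by rewrite /f t0; exact: is_derive_gamma_wave.
have fE t : t \in (`]0, +oo[%classic : set R) -> f t = gamma_wave' x y a t.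
  by rewrite inE /= in_itv /= andbT /f => ->.
split; first by apply: eq_integrable i1 => // t tD; rewrite /= fE.
transitivity (\int[mu]_(t in `]0, +oo[) f t); first by apply: eq_Rintegral => t /fE ->.
by rewrite i2 /F ltxx oppr0.
Unshelve. all: by end_near. Qed.

End GammaIntegrals.

(** * Functional equation, nonvanishing and differentiability of Gamma *)

Section GammaFunction.
Context {R : realType}.
Local Notation mu := (@lebesgue_measure R).
Local Notation D := (`]0, +oo[%classic : set R).
Local Notation nrm := Normc.normc.
Local Notation Re := complex.Re.
Local Notation Im := complex.Im.
Implicit Types (p t x y a : R) (z s : R[i]).

(** On the half-line this is [exp(-t) / t]: the shift by one in [t^(z-1)] goes into the weight, so
    that Gamma is a Mellin transform in [z] itself. *)
Definition gamma_weight t : R[i] := (expR (- t - ln t))%:C.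
Definition gamma_dom t : R := expR (- (2^-1 * t)).
Definition gamma_bound y := expR (gamma_cst (y - 1)).

Lemma measurable_halfline : (R.-ocitv.-measurable).-sigma.-measurable D.
Proof. exact: measurable_itv. Qed.

Lemma measurable_ln_halfline : measurable_fun D (@ln R).
Proof. exact: measurable_funTS (@measurable_ln R). Qed.

Lemma measurable_gamma_weight : measurable_funC D gamma_weight.
Proof.
apply: measurable_funC_real; apply: measurableT_comp => //.
by apply: measurable_funB; [exact: measurable_funN|exact: measurable_ln_halfline].
Qed.

Lemma integrable_gamma_dom : mu.-integrable D (EFin \o gamma_dom).
Proof. by apply: integrable_expRN. Qed.

Lemma gamma_weight_le y t : 1 < y -> D t ->
  nrm (gamma_weight t) * expR (y * ln t) <= gamma_bound y * gamma_dom t.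
Proof.
move=> y1 tD; have t0 : 0 < t by move: tD; rewrite /= in_itv /= andbT.
rewrite /gamma_weight normcR gtr0_norm ?expR_gt0 // -expRD.
rewrite (_ : - t - ln t + y * ln t = (y - 1) * ln t - t); last by ring.
by apply: expR_gamma_le => //; lra.
Qed.

Local Notation gamma_integrand := (mellin_integrand gamma_weight (@ln R)).

Lemma GammaC_mellin z : GammaC z = mellin mu D gamma_weight (@ln R) z.
Proof.
apply: eq_integralC => t; rewrite inE /= in_itv /= andbT => t0.
rewrite powC_real // /mellin_integrand /gamma_weight -!expC_real -!expCD.
by congr expC; rewrite !(rmorphB, rmorphN) /=; ring.
Qed.

Lemma gamma_integrandE x y t : gamma_integrand (x +i* y) t =
  (expR ((x - 1) * ln t - t))%:C * (cos (y * ln t) +i* sin (y * ln t)).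
Proof.
rewrite /mellin_integrand /gamma_weight /expC ReZ ImZ /= mulrA -rmorphM -expRD.
by congr ((expR _)%:C * _); ring.
Qed.

Lemma integrable_gamma_integrand z : 1 < Re z -> integrableC mu D (gamma_integrand z).
Proof.
apply: (mellin_integrable (mu := mu) _ integrable_gamma_dom measurable_gamma_weight
  measurable_ln_halfline gamma_weight_le).
exact: measurable_halfline.
Qed.

(** Integration by parts: [z t^(z-1) exp(-t) - t^z exp(-t)] is the derivative of [t^z exp(-t)],
    whose two components are waves of phases [0] and [- pi / 2]. *)
Lemma GammaC_addr1 z : 1 < Re z -> GammaC (z + 1) = z * GammaC z.
Proof.
case: z => x y /= x1; set z := x +i* y.
have mD := measurable_halfline.
have i1 : integrableC mu D (gamma_integrand z) by exact: integrable_gamma_integrand.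
have i2 : integrableC mu D (gamma_integrand (z + 1)).
  by apply: integrable_gamma_integrand; rewrite ReD /=; lra.
have gE t : t \in D -> z * gamma_integrand z t + -1 * gamma_integrand (z + 1) t =
    gamma_wave' x y 0 t +i* gamma_wave' x y (- (pi / 2)) t.
  rewrite inE /= in_itv /= andbT => t0.
  have -> : gamma_integrand (z + 1) t = gamma_integrand z t * t%:C.
    rewrite /mellin_integrand mulrDl mul1r expCD expC_real lnK ?posrE //.
    by rewrite mulrA.
  rewrite gamma_integrandE /gamma_wave' addr0 cosBpihalf sinBpihalf.
  by apply/eqP; rewrite eq_complex; simpc => /=; apply/andP; split; apply/eqP; ring.
have : integralC mu D (fun t => z * gamma_integrand z t + -1 * gamma_integrand (z + 1) t) = 0.
  rewrite (@eq_integralC _ _ _ mu D _ _ gE) /integralC /=.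
  have [_ ->] := Rintegral_gamma_wave' y 0 x1.
  by have [_ ->] := Rintegral_gamma_wave' y (- (pi / 2)) x1.
rewrite (integralCD mD); [|exact: integrableCZ|exact: integrableCZ].
rewrite !(integralCZ mD) // -!/(mellin _ _ _ _ _) -!GammaC_mellin mulN1r.
by move/eqP; rewrite subr_eq0 => /eqP.
Qed.

Definition gammaR p : R := \int[mu]_(t in D) expR ((p - 1) * ln t - t).

Lemma integrable_gammaR p : 1 <= p ->
  mu.-integrable D (EFin \o (fun t => expR ((p - 1) * ln t - t))).
Proof.
move=> p1; have iE : mu.-integrable D (fun t => (expR (gamma_cst (p - 1)) * gamma_dom t)%:E).
  under [X in integrable _ _ X]eq_fun do rewrite EFinM.
  by apply: integrableZl; [exact: measurable_halfline|exact: integrable_gamma_dom].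
apply: le_integrable iE => //.
  apply/measurable_EFinP; apply: measurableT_comp => //; apply: measurable_funB => //.
  by apply: measurable_funM => //; exact: measurable_ln_halfline.
move=> t /=; rewrite in_itv /= andbT => t0; rewrite lee_fin.
rewrite !ger0_norm ?mulr_ge0 ?expR_ge0 //.
by apply: expR_gamma_le => //; lra.
Qed.

Lemma gammaR_gt0 p : 1 <= p -> 0 < gammaR p.
Proof.
move=> p1; rewrite -lte_fin /gammaR /Rintegral fineK; last first.
  by apply: integrable_fin_num; [exact: measurable_halfline|exact: integrable_gammaR].
have /measurable_int mf := integrable_gammaR p1.
have sub : `[1, 2]%classic `<=` D.
  by move=> t /=; rewrite !in_itv /= => /andP[t1 _]; rewrite andbT; lra.
(* On [[1, 2]] one has [ln t >= 0] and [t <= 2], so the integrand is at least [expR (- 2)] there. *)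
have h1 : (0%:E < \int[mu]_(t in `[1%R, 2%R]) (expR (- 2))%:E)%E.
  rewrite integral_cst //= lebesgue_measure_itv /= lte_fin ltr1n /=.
  by rewrite -EFinD -EFinM lte_fin mulr_gt0 ?expR_gt0 //; lra.
have h2 : (\int[mu]_(t in `[1%R, 2%R]) (expR (- 2))%:E <=
    \int[mu]_(t in `[1%R, 2%R]) (expR ((p - 1) * ln t - t))%:E)%E.
  apply: ge0_le_integral => //.
  - by apply: measurable_funS mf.
  - move=> t /=; rewrite in_itv /= => /andP[t1 t2]; rewrite lee_fin ler_expR.
    have : 0 <= (p - 1) * ln t by rewrite mulr_ge0 ?ln_ge0 //; lra.
    by lra.
apply: lt_le_trans h1 (le_trans h2 _).
apply: ge0_subset_integral => // t _; by rewrite lee_fin expR_ge0.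
Qed.

Lemma gammaR_addr1 p : 1 < p -> gammaR (p + 1) = p * gammaR p.
Proof.
move=> p1; have [_ H] := Rintegral_gamma_wave' 0 0 p1.
have mD := measurable_halfline.
have i1 := integrable_gammaR (ltW p1).
have i2 : mu.-integrable D (EFin \o (fun t => expR ((p + 1 - 1) * ln t - t))).
  by apply: integrable_gammaR; lra.
have i3 : mu.-integrable D (EFin \o (fun t => p * expR ((p - 1) * ln t - t))).
  by under [X in integrable _ _ X]eq_fun do rewrite /comp EFinM; exact: integrableZl.
apply/esym/eqP; rewrite -subr_eq0 -H /gammaR -RintegralZl // -RintegralB //.
apply/eqP; apply: eq_Rintegral => t; rewrite inE /= in_itv /= andbT => t0.
rewrite /gamma_wave' mul0r addr0 cos0 mulr1 mul0r subr0 addrK.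
rewrite (_ : p * ln t - t = (p - 1) * ln t - t + ln t); last by ring.
by rewrite (expRD (_ - t)) lnK ?posrE //; ring.
Qed.

(** With [a = ln t / 2], [u = expR a] and [v = expR (- a)], the claim is [a^2 <= (u - v)^2]: for
    [a >= 0] because [u >= 1 + a] and [v <= 1], and symmetrically for [a < 0]. *)
Lemma sqr_ln_le t : 0 < t -> ln t ^+ 2 <= 4 * (t + t^-1 - 2).
Proof.
move=> t0; set a := ln t / 2; have la : ln t = a + a by rewrite -splitr.
have := expR_ge1Dx a; have := expR_ge1Dx (- a).
have -> : t^-1 = expR (- a) * expR (- a).
  by rewrite -expRD -opprD -la expRN lnK ?posrE.
have {2}-> : t = expR a * expR a by rewrite -expRD -la lnK ?posrE.
have : expR a * expR (- a) = 1 by rewrite -expRD subrr expR0.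
have := expR_gt0 a; have := expR_gt0 (- a); rewrite la.
set u := expR a; set v := expR (- a) => v0 u0 uv hv hu.
have : a ^+ 2 <= (u - v) ^+ 2.
  have [a0|a0] := lerP 0 a.
    have u1 : 1 <= u by lra.
    have v1 : v <= 1 by nra.
    by rewrite ler_pXn2r ?nnegrE //; lra.
  have v1 : 1 <= v by lra.
  have u1 : u <= 1 by nra.
  by rewrite -sqrrN -[leRHS]sqrrN ler_pXn2r ?nnegrE //; lra.
by nra.
Qed.

(* From [cos b >= 1 - b^2] and [sqr_ln_le] at [t / x]: the lower bound is a
   combination of Gamma densities of shapes [x], [x + 1] and [x - 1]. *)
Lemma gamma_wave_ge x y t : 0 < x -> 0 < t ->
  (1 + 8 * y ^+ 2) * expR ((x - 1) * ln t - t)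
    - 4 * y ^+ 2 / x * expR ((x + 1 - 1) * ln t - t)
    - 4 * y ^+ 2 * x * expR ((x - 1 - 1) * ln t - t)
  <= expR ((x - 1) * ln t - t) * cos (y * ln t - y * ln x).
Proof.
move=> x0 t0; set e := expR ((x - 1) * _ - _).
have -> : expR ((x + 1 - 1) * ln t - t) = e * t.
  by rewrite -{3}[t]lnK ?posrE // -expRD; congr expR; ring.
have -> : expR ((x - 1 - 1) * ln t - t) = e / t.
  by rewrite -{3}[t]lnK ?posrE // -expRN -expRD; congr expR; ring.
have e0 : 0 < e by exact: expR_gt0.
have [+ _] := cos_sin_bounds (y * ln t - y * ln x).
rewrite -mulrBr -ln_div ?posrE // exprMn ler_norml => /andP[H _].
have := sqr_ln_le (divr_gt0 t0 x0); rewrite invf_div => H2.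
have H3 : y ^+ 2 * ln (t / x) ^+ 2 <= y ^+ 2 * (4 * (t / x + x / t - 2)).
  by rewrite ler_wpM2l ?sqr_ge0.
rewrite (_ : _ - _ - _ = e * (1 - y ^+ 2 * (4 * (t / x + x / t - 2)))); last first.
  by field; rewrite !gt_eqF.
by rewrite ler_pM2l //; lra.
Qed.

(* The Gamma distribution of large shape [x] concentrates at [x] on the
   logarithmic scale, so that the phase [y * ln t] is nearly constant. *)
Lemma GammaC_neq0_large x y : 2 < x -> 4 * y ^+ 2 < x - 1 -> GammaC (x +i* y) != 0.
Proof.
move=> x2 yx; apply/eqP => G0.
have mD := measurable_halfline.
have x0 : 0 < x by lra.
have [ic is_] : integrableC mu D (gamma_integrand (x +i* y)).
  by apply: integrable_gamma_integrand => /=; lra.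
move: G0; rewrite GammaC_mellin => /eqP; rewrite eq_complex /= => /andP[/eqP c0 /eqP s0].
(* The phase of [t^(iy)] at the concentration point [t = x]. Rotating by it gives the real part of
   [exp(-ia) Gamma(x+iy)], which would be 0. *)
pose a := y * ln x.
have iZ (c : R) f : mu.-integrable D (EFin \o f) -> mu.-integrable D (EFin \o (fun t => c * f t)).
  by move=> fi; under [X in integrable _ _ X]eq_fun do rewrite /comp EFinM; exact: integrableZl.
have W0 : \int[mu]_(t in D) (expR ((x - 1) * ln t - t) * cos (y * ln t - a)) = 0.
  transitivity (\int[mu]_(t in D) (cos a * Re (gamma_integrand (x +i* y) t) +
                                   sin a * Im (gamma_integrand (x +i* y) t))).
    apply: eq_Rintegral => t _; rewrite gamma_integrandE ReZl ImZl /= cosB; ring.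
  rewrite RintegralD //; [|exact: iZ|exact: iZ].
  by rewrite !RintegralZl // c0 s0 !mulr0 addr0.
have iW : mu.-integrable D (EFin \o (fun t => expR ((x - 1) * ln t - t) * cos (y * ln t - a))).
  have := integrableD mD (iZ (cos a) _ ic) (iZ (sin a) _ is_).
  apply: eq_integrable => // t _.
  transitivity ((cos a * Re (gamma_integrand (x +i* y) t) +
                 sin a * Im (gamma_integrand (x +i* y) t))%:E) => //.
  by rewrite gamma_integrandE ReZl ImZl /= cosB; congr EFin; ring.
have i0 : mu.-integrable D (EFin \o (fun t => expR ((x - 1) * ln t - t))).
  by apply: integrable_gammaR; lra.
have i1 : mu.-integrable D (EFin \o (fun t => expR ((x + 1 - 1) * ln t - t))).
  by apply: integrable_gammaR; lra.
have i2 : mu.-integrable D (EFin \o (fun t => expR ((x - 1 - 1) * ln t - t))).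
  by apply: integrable_gammaR; lra.
pose A (c : R) p (t : R) := c * expR ((p - 1) * ln t - t).
pose c0' := 1 + 8 * y ^+ 2; pose c1 := 4 * y ^+ 2 / x; pose c2 := 4 * y ^+ 2 * x.
have iA : mu.-integrable D (EFin \o (fun t => A c0' x t - A c1 (x + 1) t)).
  by apply: eq_integrable (integrableB mD (iZ c0' _ i0) (iZ c1 _ i1)).
have iB : mu.-integrable D (EFin \o (fun t => A c0' x t - A c1 (x + 1) t - A c2 (x - 1) t)).
  by apply: eq_integrable (integrableB mD iA (iZ c2 _ i2)).
have : \int[mu]_(t in D) (A c0' x t - A c1 (x + 1) t - A c2 (x - 1) t) <= 0.
  rewrite -[leRHS]W0; apply: le_Rintegral => // t /=; rewrite in_itv /= andbT => t0.
  exact: gamma_wave_ge.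
rewrite RintegralB //; last exact: iZ.
rewrite RintegralB //; [|exact: iZ|exact: iZ].
rewrite !RintegralZl // -!/(gammaR _) gammaR_addr1; last by lra.
have := @gammaR_addr1 (x - 1); rewrite subrK => -> ; last by lra.
have : 0 < gammaR (x - 1) by apply: gammaR_gt0; lra.
set g := gammaR (x - 1) => g0.
(* The functional equation has reduced the three masses to [x (x-1) g], [(x-1) g] and [g]. The terms
   in [y^2 x] cancel, leaving a factor that is positive by hypothesis. *)
rewrite (_ : _ - _ - _ = (x - 1 - 4 * y ^+ 2) * g); last first.
  by rewrite /c0' /c1 /c2; field; rewrite gt_eqF.
by rewrite leNgt mulr_gt0 //; lra.
Qed.

Lemma GammaC_neq0 z : 1 < Re z -> GammaC z != 0.
Proof.
move=> z1; apply/eqP => G0.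
have Gn n : GammaC (z + n%:R) = 0.
  elim: n => [|n IH]; first by rewrite addr0.
  rewrite -natr1 addrA GammaC_addr1 ?IH ?mulr0 //.
  by rewrite ReD (_ : n%:R = (n%:R : R)%:C) /= ?ltr_wpDr // rmorph_nat.
(* Large enough for both hypotheses of [GammaC_neq0_large] at real part [Re z + n]. *)
pose n := (Num.truncn (4 * Im z ^+ 2 + 2)).+1.
have nn : 4 * Im z ^+ 2 + 2 < n%:R by exact: truncnS_gt.
have zn : z + n%:R = (Re z + n%:R) +i* Im z.
  rewrite (_ : n%:R = (n%:R : R)%:C); last by rewrite rmorph_nat.
  by apply/eqP; rewrite eq_complex ReD ImD /= addr0 !eqxx.
have := @GammaC_neq0_large (Re z + n%:R) (Im z).
rewrite -zn Gn eqxx => H.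
have := sqr_ge0 (Im z) => y0.
have : false by apply: H; lra.
by [].
Qed.

Lemma derivable_GammaC_half (s : R[i]^o) : 1 < Re s ->
  derivable (fun s : R[i]^o => GammaC ((s + 1) / 2) : R[i]^o) s 1.
Proof.
move=> s1; pose z := (s + 1) / 2; pose e := (Re z - 1) / 2.
have half (w : R[i]) : w / 2 = (2^-1 : R)%:C * w.
  by rewrite mulrC fmorphV /= rmorph_nat.
have z1 : 1 < Re z by rewrite /z half ReZl ReD /=; lra.
have e0 : 0 < e by rewrite /e; lra.
have mD := measurable_halfline.
pose G' := mellin_deriv mu D gamma_weight (@ln R) z.
(* The argument of Gamma moves by [k / 2]: its square yields [4^-1], and [|k| <= e] is the radius
   [e / 2] that [mellin_taylor] asks for. *)
apply: (@derivable_quad _ _ s (G' / 2) e (4^-1 * (48 * e ^- 2 *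
  (gamma_bound (Re z + e) + gamma_bound (Re z - e)) *
  (2 * \int[mu]_(t in D) gamma_dom t)))) => // k ke.
have k2 : nrm (k / 2) = nrm k / 2.
  by rewrite half Normc.normcM normcR ger0_norm ?invr_ge0 // mulrC.
have -> : (k + s + 1) / 2 = k / 2 + z by rewrite /z; field.
have -> : k * (G' / 2) = (k / 2) * G' by field.
rewrite !GammaC_mellin.
have := @mellin_taylor _ _ _ mu D mD gamma_dom gamma_weight (@ln R) gamma_bound 1
  integrable_gamma_dom measurable_gamma_weight measurable_ln_halfline gamma_weight_le
  z (k / 2) e e0.
rewrite k2 ler_pM2r ?invr_gt0 // => /(_ _ ke) H.
apply: le_trans (H _) _; first by rewrite /e; lra.
rewrite expr_div_n (_ : 2 ^+ 2 = 4); last by ring.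
by rewrite le_eqVlt; apply/orP; left; apply/eqP; ring.
Qed.

End GammaFunction.

(** * The zeta series *)

Section ZetaSeriesBound.
Context {R : realType}.
Implicit Types (y : R).

(* Telescoping bound: [(n - 1)^-p - n^-p >= p n^-(p + 1)] with [p = y - 1]. *)
Lemma sum_expR_ln_le y N : 1 < y ->
  \sum_(1 <= n < N) expR (- (y * ln n%:R)) <= 1 + (y - 1)^-1.
Proof.
move=> y1; pose p := y - 1; have p0 : 0 < p by rewrite /p; lra.
have pV : 0 < p^-1 by rewrite invr_gt0.
suff H n : \sum_(1 <= k < n.+2) expR (- (y * ln k%:R)) <=
    1 + p^-1 - p^-1 * expR (- (p * ln n.+1%:R)).
  case: N => [|[|N]]; try by rewrite big_geq // addr_ge0 // ltW.
  by apply: le_trans (H N) _; rewrite gerBl mulr_ge0 ?expR_ge0 // ltW.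
elim: n => [|n IH].
  by rewrite big_nat1 ln1 !mulr0 oppr0 expR0 mulr1 addrK.
rewrite big_nat_recr //=; apply: le_trans (lerD IH (lexx _)) _.
set u := n.+1%:R; set v := n.+2%:R.
have u0 : 0 < u :> R by rewrite ltr0n.
have v0 : 0 < v :> R by rewrite ltr0n.
have vu : v = u + 1 by rewrite /v /u -natr1.
clearbody u v.
have lnuv : ln u <= ln v - v^-1.
  have := @ln_le_subr1 R (u / v) (divr_gt0 u0 v0).
  rewrite ln_div ?posrE // (_ : u / v - 1 = - v^-1); first by lra.
  by rewrite vu; field; rewrite -vu gt_eqF.
have vinv : expR (- (y * ln v)) = v^-1 * expR (- (p * ln v)).
  rewrite (_ : - (y * ln v) = - ln v + - (p * ln v)); last by rewrite /p; ring.
  by rewrite expRD expRN lnK ?posrE.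
(* That is [(1 + p / v) v^-p <= u^-p], the convexity inequality that makes the sum telescope. *)
have step : (1 + p * v^-1) * expR (- (p * ln v)) <= expR (- (p * ln u)).
  apply: (@le_trans _ _ (expR (p * v^-1) * expR (- (p * ln v)))).
    by rewrite ler_wpM2r ?expR_ge0 ?expR_ge1Dx.
  rewrite -expRD ler_expR; nra.
rewrite vinv; set X := expR (- (p * ln v)) in step *; set Y := expR (- (p * ln u)) in step *.
have : p^-1 * ((1 + p * v^-1) * X) <= p^-1 * Y by rewrite ler_wpM2l // ltW.
rewrite (_ : p^-1 * _ = p^-1 * X + v^-1 * X); last by field; rewrite !gt_eqF.
lra.
Qed.

End ZetaSeriesBound.

(** * An integrable majorant on the quadrant *)

Section QuadrantDomination.
Context {R : realType}.
Local Notation mu := (@lebesgue_measure R).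
Local Notation D := (`]0, +oo[%classic : set R).
(* [lebesgue_measure] lives on this type, whose measurable structure has another
   display than the default one on [R]. *)
Local Notation RL := (g_sigma_algebraType (R.-ocitv.-measurable)).
Local Notation Q := (@quadrant R : set (RL * RL)%type).

Definition quadrant_dom (p : R * R) : R := expR (- p.1) * expR (- p.2).

Lemma quadrantP (p : R * R) : Q p <-> 0 < p.1 /\ 0 < p.2.
Proof.
rewrite /quadrant; case: p => u v; split => [[]|[u0 v0]] /=; rewrite ?in_itv /= ?andbT //.
Qed.

Lemma quadrant_dom_ge0 p : Q p -> 0 <= quadrant_dom p.
Proof. by move=> _; rewrite mulr_ge0 ?expR_ge0. Qed.

(** Extended by zero, the majorant becomes a product on the whole plane, to which Tonelli's
    criterion applies. *)
Let e0 (u : R) : R := if 0 < u then expR (- u) else 0.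

Let me0 : measurable_fun setT e0.
Proof.
apply: measurable_fun_ifT => //; first exact: measurable_fun_ltr.
by apply: measurableT_comp => //; exact: measurable_funN.
Qed.

Let e0_ge0 u : 0 <= e0 u.
Proof. by rewrite /e0; case: ifP => // _; exact: expR_ge0. Qed.

Let integral_e0 : (\int[mu]_u (e0 u)%:E = 1)%E.
Proof.
transitivity (\int[mu]_(u in D) (expR (- (1 * u)))%:E)%E.
  rewrite [RHS]integral_mkcond; apply: eq_integral => u _.
  rewrite patchE /e0 mul1r; case: ifPn => u0; case: ifPn => // /negP.
    by rewrite inE /= in_itv /= andbT u0.
  by rewrite notK inE /= in_itv /= andbT (negbTE u0).
rewrite integral_itv_obnd_cbnd; first by rewrite integral_expRN // invr1.
have mf := continuous_measurable_fun (@continuous_expRN R 1).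
by apply/measurable_EFinP; exact: measurable_funTS mf.
Qed.

Lemma measurable_quadrant : measurable Q.
Proof. by apply: measurableX; exact: measurable_halfline. Qed.

Lemma integrable_quadrant_dom :
  (@plane_measure R).-integrable Q (EFin \o quadrant_dom).
Proof.
apply/integrable_mkcond; first exact: measurable_quadrant.
have -> : (EFin \o quadrant_dom) \_ Q = (fun p => (e0 p.1 * e0 p.2)%:E).
  apply/funext => p; rewrite patchE /e0 /quadrant_dom /=.
  case: ifPn => [|/negP]; rewrite inE quadrantP; first by move=> [-> ->].
  case: ifPn => u0; case: ifPn => v0; rewrite ?mul0r ?mulr0 //.
  by move=> /(_ (conj isT isT)).
have mf : measurable_fun setT (fun p : R * R => (e0 p.1 * e0 p.2)%:E).
  apply/measurable_EFinP; apply: measurable_funM; exact: measurableT_comp.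
apply/(integrable12ltyP mu mu mf).
have mE : measurable_fun setT (fun v => (e0 v)%:E) by apply/measurable_EFinP.
have inner u : (\int[mu]_v `|(e0 u * e0 v)%:E| = (e0 u)%:E)%E.
  under eq_integral => v _ do rewrite /= ger0_norm ?mulr_ge0 // EFinM.
  by rewrite ge0_integralZl ?integral_e0 ?mule1 // => *; rewrite lee_fin.
by under eq_integral => u _ do rewrite /= inner; rewrite integral_e0 ltry.
Qed.

End QuadrantDomination.

(** * Series of Mellin integrals for a general kernel *)

Section ZetaKernel.
Context {R : realType}.
Local Notation RL := (g_sigma_algebraType (R.-ocitv.-measurable)).
Local Notation Q := (@quadrant R : set (RL * RL)%type).
Local Notation mu2 := (@plane_measure R).
Local Notation nrm := Normc.normc.
Local Notation Re := complex.Re.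
Local Notation Im := complex.Im.
Implicit Types (g : R * R -> R[i]) (p : R * R) (y b c A : R) (s w : R[i]) (n : nat).

(** The Gaussian times [g / (u v)]: the division accounts for the exponent [s - 1] of [u v], as for
    Gamma. The kernel [g] is a parameter, to treat [sin * sinh], its limit [u v] and their
    difference alike. *)
Definition zeta_weight g p : R[i] :=
  (expR (- (p.1 ^+ 2 + p.2 ^+ 2) - ln (p.1 * p.2)))%:C * g p.

Definition zeta_base b n p : R := (n%:R * p.1) ^+ 2 + b ^+ 2 * p.2 ^+ 2.

Definition zeta_log b n p : R := ln (p.1 * p.2) - ln (zeta_base b n p) / 2.

(** Summable in [n] for [y > 1], and linear in [A], so that a small kernel gives a small sum. *)
Definition zeta_bound A c n y : R :=
  A * expR ((c + y + 1) ^+ 2 / 2) * expR (- (y * ln n%:R)).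

(** The factor [u v] cancels the division by [u v] in [zeta_weight]; the exponential growth is
    beaten by the Gaussian. *)
Definition kernel_le g A c : Prop :=
  measurable_funC Q g /\
  forall p, Q p -> nrm (g p) <= A * (p.1 * p.2) * expR (c * (p.1 + p.2)).

Lemma zeta_base_gt0 b n p : (0 < n)%N -> Q p -> 0 < zeta_base b n p.
Proof.
move=> n0 /quadrantP[u0 v0]; rewrite ltr_pwDl ?exprn_gt0 ?mulr_gt0 ?ltr0n //.
by rewrite mulr_ge0 ?sqr_ge0.
Qed.

Lemma measurable_quadrant_fst : measurable_fun Q (fst : R * R -> R).
Proof. exact: measurable_funTS measurable_fst. Qed.

Lemma measurable_quadrant_snd : measurable_fun Q (snd : R * R -> R).
Proof. exact: measurable_funTS measurable_snd. Qed.

Lemma measurable_zeta_weight g : measurable_funC Q g -> measurable_funC Q (zeta_weight g).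
Proof.
move=> mg; apply: measurable_funCM => //; apply: measurable_funC_real.
have m1 := measurable_quadrant_fst; have m2 := measurable_quadrant_snd.
apply: measurableT_comp => //; apply: measurable_funB.
  by apply: measurable_funN; apply: measurable_funD; exact: measurable_funX.
by apply: (measurableT_comp (@measurable_ln R)); exact: measurable_funM.
Qed.

Lemma measurable_zeta_log b n : measurable_fun Q (zeta_log b n).
Proof.
have m1 := measurable_quadrant_fst; have m2 := measurable_quadrant_snd.
apply: measurable_funB.
  by apply: (measurableT_comp (@measurable_ln R)); exact: measurable_funM.
apply: measurable_funM => //; apply: (measurableT_comp (@measurable_ln R)).
apply: measurable_funD; first by apply: measurable_funX; exact: measurable_funM.
by apply: measurable_funM => //; exact: measurable_funX.
Qed.

(** Only [(n u)^2] is kept in the base, whose square root [n u] cancels the [u] of [u v]. The bound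
    is uniform in [b], including [b = 0]. *)
Lemma zeta_log_le b n p : (0 < n)%N -> Q p -> zeta_log b n p <= ln p.2 - ln n%:R.
Proof.
move=> n0 Qp; have [u0 v0] := (quadrantP p).1 Qp.
have n1 : 0 < n%:R :> R by rewrite ltr0n.
have nu : 0 < n%:R * p.1 by rewrite mulr_gt0.
have : ln ((n%:R * p.1) ^+ 2) <= ln (zeta_base b n p).
  rewrite ler_ln ?posrE ?zeta_base_gt0 ?exprn_gt0 //.
  by rewrite lerDl mulr_ge0 ?sqr_ge0.
rewrite lnXn // lnM ?posrE // /zeta_log lnM ?posrE //; lra.
Qed.

Lemma zeta_weight_le g A c b n : (0 < n)%N -> 0 <= A -> 0 <= c -> kernel_le g A c ->
  forall y p, 1 < y -> Q p ->
  nrm (zeta_weight g p) * expR (y * zeta_log b n p) <=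
    zeta_bound A c n y * quadrant_dom p.
Proof.
move=> n0 A0 c0 [_ gA] y p y1 Qp; have [u0 v0] := (quadrantP p).1 Qp.
rewrite /zeta_weight Normc.normcM normcR gtr0_norm ?expR_gt0 //.
have uv0 : 0 < p.1 * p.2 by rewrite mulr_gt0.
set e1 := expR _; set e2 := expR _.
have H1 : e1 * nrm (g p) <= A * (expR (- (p.1 ^+ 2 + p.2 ^+ 2)) * expR (c * (p.1 + p.2))).
  apply: le_trans (ler_wpM2l (expR_ge0 _) (gA p Qp)) _.
  rewrite /e1 expRD (expRN (ln _)) lnK ?posrE // le_eqVlt; apply/orP; left; apply/eqP.
  by field; rewrite gt_eqF // (gt_eqF u0).
have H2 : e2 <= expR (y * (p.2 - ln n%:R)).
  rewrite ler_expR ler_wpM2l //; first by lra.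
  by apply: le_trans (zeta_log_le b n0 Qp) _; have := ln_le_subr1 v0; lra.
apply: le_trans (ler_pM _ (expR_ge0 _) H1 H2) _.
  by rewrite mulr_ge0 ?expR_ge0 ?normc_ge0.
rewrite /zeta_bound /quadrant_dom -!mulrA ler_wpM2l // -!expRD ler_expR.
set u := p.1 in u0 *; set v := p.2 in v0 *; set l := ln _.
(* Completing squares bounds [(c + y + 1) u - u^2] and its analogue in [v] by [(c + y + 1)^2 / 4]
   each; the summand 1 leaves the decay [exp(-u-v)]. *)
have : 0 <= ((c + y + 1) / 2 - u) ^+ 2 by exact: sqr_ge0.
have : 0 <= ((c + y + 1) / 2 - v) ^+ 2 by exact: sqr_ge0.
have : 0 <= y * u by rewrite mulr_ge0 //; lra.
nra.
Qed.

Lemma zeta_weight_integrandE b n s g p : (0 < n)%N -> Q p ->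
  powC (p.1 * p.2)%:C (s - 1) * (expR (- (p.1 ^+ 2 + p.2 ^+ 2)))%:C * g p /
  powC (zeta_base b n p)%:C (s / 2) =
  mellin_integrand (zeta_weight g) (zeta_log b n) s p.
Proof.
move=> n0 Qp; have [u0 v0] := (quadrantP p).1 Qp.
rewrite !powC_real ?mulr_gt0 ?zeta_base_gt0 // -expCN /mellin_integrand /zeta_weight.
rewrite -!expC_real (mulrAC _ (g p)) [RHS]mulrAC -!expCD; congr (expC _ * _).
rewrite /zeta_log !rmorphD !rmorphN /= rmorphM fmorphV /= rmorph_nat; ring.
Qed.

Definition zeta_term_of b g n s : R[i] :=
  mellin mu2 Q (zeta_weight g) (zeta_log b n) s.

Definition zeta_sum b g s : R[i]^o :=
  limn (fun N => \sum_(1 <= n < N) zeta_term_of b g n s : R[i]^o).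

Local Notation K := (2 * \int[mu2]_(p in Q) quadrant_dom p)%R.

Lemma Rintegral_quadrant_dom_ge0 : 0 <= K.
Proof. by rewrite mulr_ge0 // Rintegral_ge0 // => p Qp; exact: quadrant_dom_ge0. Qed.

Section KernelBounded.
Variables (g : R * R -> R[i]) (A c b : R).
Hypotheses (A0 : 0 <= A) (c0 : 0 <= c) (gA : kernel_le g A c).

Let mh : measurable_funC Q (zeta_weight g) := measurable_zeta_weight gA.1.

Lemma zeta_term_integrable n s : (0 < n)%N -> 1 < Re s ->
  integrableC mu2 Q (mellin_integrand (zeta_weight g) (zeta_log b n) s).
Proof.
move=> n0 s1; exact: (mellin_integrable measurable_quadrant integrable_quadrant_dom mh
  (measurable_zeta_log b n) (zeta_weight_le b n0 A0 c0 gA) s1).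
Qed.

Lemma zeta_term_le n s : (0 < n)%N -> 1 < Re s ->
  nrm (zeta_term_of b g n s) <= zeta_bound A c n (Re s) * K.
Proof.
move=> n0 s1; exact: (normc_mellin_le measurable_quadrant integrable_quadrant_dom mh
  (measurable_zeta_log b n) (zeta_weight_le b n0 A0 c0 gA) s1).
Qed.

Lemma sum_zeta_bound_le y N : 1 < y ->
  \sum_(1 <= n < N) zeta_bound A c n y <=
  A * expR ((c + y + 1) ^+ 2 / 2) * (1 + (y - 1)^-1).
Proof.
move=> y1; rewrite -mulr_sumr ler_wpM2l ?sum_expR_ln_le //.
by rewrite mulr_ge0 ?expR_ge0.
Qed.

Lemma sum_zeta_boundK_le y N : 1 < y ->
  \sum_(1 <= n < N) zeta_bound A c n y * K <=
  A * (expR ((c + y + 1) ^+ 2 / 2) * (1 + (y - 1)^-1) * K).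
Proof.
move=> y1; rewrite -mulr_suml.
apply: le_trans (ler_wpM2r Rintegral_quadrant_dom_ge0 (sum_zeta_bound_le N y1)) _.
by rewrite !mulrA.
Qed.

Lemma cvg_zeta_sum s : 1 < Re s ->
  (fun N => \sum_(1 <= n < N) zeta_term_of b g n s : R[i]^o) @ \oo --> zeta_sum b g s.
Proof.
move=> s1; suff : cvgn (fun N => \sum_(1 <= n < N) zeta_term_of b g n s : R[i]^o) by [].
apply: cvgn_sumC_dominated (fun N => sum_zeta_boundK_le N s1) => n n0.
exact: zeta_term_le.
Qed.

Lemma normc_zeta_sum_le s : 1 < Re s -> nrm (zeta_sum b g s) <=
  A * (expR ((c + Re s + 1) ^+ 2 / 2) * (1 + (Re s - 1)^-1) * K).
Proof.
move=> s1; apply: (normc_lim_le (cvg_zeta_sum s1)).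
apply: normc_sum_le (fun N => sum_zeta_boundK_le N s1) => n n0.
exact: zeta_term_le.
Qed.

Lemma derivable_zeta_sum (s : R[i]^o) : 1 < Re s ->
  derivable (zeta_sum b g : R[i]^o -> R[i]^o) s 1.
Proof.
move=> s1; pose e := (Re s - 1) / 2; have e0 : 0 < e by rewrite /e; lra.
have se : 1 < Re s - e by rewrite /e; lra.
have re k : nrm k <= e / 2 -> 1 < Re (k + s).
  move=> ke; have := le_trans (normcRe k) ke; rewrite ler_norml => /andP[h _].
  by rewrite ReD; rewrite /e in se h *; lra.
(* One constant for both the Taylor remainder ([48 e^-2]) and the derivative ([e^-1]), as
   [derivable_series] wants a single sequence [q]. *)
pose M := 48 * e ^- 2 + e^-1.
have M1 : 48 * e ^- 2 <= M by rewrite lerDl invr_ge0 ltW.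
have M2 : e^-1 <= M by rewrite lerDr mulr_ge0 // invr_ge0 exprn_ge0 // ltW.
pose q n := M * ((zeta_bound A c n (Re s + e) + zeta_bound A c n (Re s - e)) * K).
have zb0 n y : 0 <= zeta_bound A c n y by rewrite !mulr_ge0 ?expR_ge0.
have q0 n : 0 <= (zeta_bound A c n (Re s + e) + zeta_bound A c n (Re s - e)) * K.
  by rewrite mulr_ge0 ?Rintegral_quadrant_dom_ge0 // addr_ge0.
have [B HB] : exists B, forall N, \sum_(1 <= n < N) q n <= B.
  eexists => N; rewrite -mulr_sumr; apply: ler_wpM2l.
    by rewrite addr_ge0 ?mulr_ge0 ?invr_ge0 ?exprn_ge0 // ltW.
  under eq_bigr do rewrite mulrDl.
  rewrite big_split /=; apply: lerD; apply: sum_zeta_boundK_le => //; lra.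
have mL n := measurable_zeta_log b n.
apply: (@derivable_series _ (zeta_term_of b g)
  (fun n => mellin_deriv mu2 Q (zeta_weight g) (zeta_log b n) s) s (e / 2)
  (fun k n => zeta_bound A c n (Re (k + s)) * K) _ q B) => //.
- by rewrite divr_gt0.
- by move=> k /re ks n n0; exact: zeta_term_le.
- by move=> k /re ks N; exact: sum_zeta_boundK_le.
- move=> n n0; apply: le_trans (normc_mellin_deriv_le measurable_quadrant
    integrable_quadrant_dom mh (mL n) (zeta_weight_le b n0 A0 c0 gA) e0 se) _.
  by rewrite -mulrA ler_wpM2r.
- move=> k ke n n0; apply: le_trans (mellin_taylor measurable_quadrant
    integrable_quadrant_dom mh (mL n) (zeta_weight_le b n0 A0 c0 gA) e0 se ke) _.
  by rewrite ler_wpM2l ?sqr_ge0 // -mulrA ler_wpM2r.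
Qed.

End KernelBounded.

(** Linearity in the kernel turns the comparison of two zeta sums near [w = 0] into a bound for the
    sum of the difference kernel. *)
Lemma zeta_sum_sub b g1 g2 w A1 c1 A2 c2 s :
  0 <= A1 -> 0 <= c1 -> kernel_le g1 A1 c1 ->
  0 <= A2 -> 0 <= c2 -> kernel_le g2 A2 c2 -> 1 < Re s ->
  zeta_sum b (fun p => g1 p - w * g2 p) s = zeta_sum b g1 s - w * zeta_sum b g2 s.
Proof.
move=> A10 c10 k1 A20 c20 k2 s1.
have H1 := cvg_zeta_sum (b := b) A10 c10 k1 s1.
have H2 := cvg_zeta_sum (b := b) A20 c20 k2 s1.
have E : (fun N => \sum_(1 <= n < N) zeta_term_of b (fun p => g1 p - w * g2 p) n s : R[i]^o) =
    fun N => \sum_(1 <= n < N) zeta_term_of b g1 n s - w * \sum_(1 <= n < N) zeta_term_of b g2 n s.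
  apply/funext => N; rewrite mulr_sumr -sumrB; apply: eq_big_nat => n /andP[n0 _].
  have i1 := zeta_term_integrable b A10 c10 k1 n0 s1.
  have i2 := zeta_term_integrable b A20 c20 k2 n0 s1.
  rewrite /zeta_term_of /mellin -mulNr -(integralCZ measurable_quadrant) //.
  rewrite -(integralCD measurable_quadrant) //; last first.
    by apply: integrableCZ => //; exact: measurable_quadrant.
  by apply: eq_integralC => p _; rewrite /mellin_integrand /zeta_weight; ring.
rewrite {1}/zeta_sum E; apply: cvg_lim; first exact: norm_hausdorff.
exact: cvg_subZ H1 H2.
Qed.

End ZetaKernel.

(** * The sine kernel, its limit at zero and the zeta function *)

Section HurwitzZetaAnalytic.
Context {R : realType}.
Local Notation RL := (g_sigma_algebraType (R.-ocitv.-measurable)).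
Local Notation Q := (@quadrant R : set (RL * RL)%type).
Local Notation nrm := Normc.normc.
Local Notation Re := complex.Re.
Local Notation Im := complex.Im.
Implicit Types (p : R * R) (a b : R) (s w : R[i]) (n : nat).

Definition sin_sinh w p : R[i] := sinC (w * p.2%:C) * sinhC (w * p.1%:C).
(** The coefficient of [w^2], the leading term of [sin (w v) sinh (w u)] at [w = 0]. *)
Definition uv_kernel p : R[i] := (p.1 * p.2)%:C.

Lemma measurable_sin_sinh w : measurable_funC Q (sin_sinh w).
Proof.
apply: measurable_funCM.
  apply: measurable_funC_sinC; apply: measurable_funCM; first exact: measurable_funC_cst.
  by apply: measurable_funC_real; exact: measurable_quadrant_snd.
apply: measurable_funC_sinhC; apply: measurable_funCM; first exact: measurable_funC_cst.
by apply: measurable_funC_real; exact: measurable_quadrant_fst.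
Qed.

Lemma measurable_uv_kernel : measurable_funC Q uv_kernel.
Proof.
apply: measurable_funC_real; apply: measurable_funM.
  exact: measurable_quadrant_fst.
exact: measurable_quadrant_snd.
Qed.

Lemma kernel_le_uv : kernel_le uv_kernel 1 0.
Proof.
split; first exact: measurable_uv_kernel.
move=> p /quadrantP[u0 v0].
by rewrite mul0r expR0 mulr1 mul1r normcR gtr0_norm // mulr_gt0.
Qed.

Let normc_scale w (t : R) : 0 < t -> nrm (w * t%:C) = nrm w * t.
Proof. by move=> t0; rewrite Normc.normcM normcR gtr0_norm. Qed.

Lemma kernel_le_sin_sinh w : kernel_le (sin_sinh w) (16 * nrm w ^+ 2) (2 * nrm w).
Proof.
split; first exact: measurable_sin_sinh.
move=> p /quadrantP[u0 v0]; rewrite /sin_sinh Normc.normcM.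
have h1 := normc_sinC_le (w * p.2%:C); have h2 := normc_sinhC_le (w * p.1%:C).
apply: le_trans (ler_pM (normc_ge0 _) (normc_ge0 _) h1 h2) _.
rewrite !normc_scale // mulrDr.
rewrite [X in _ <= _ * expR X](_ : _ = 2 * (nrm w * p.1) + 2 * (nrm w * p.2)).
  by rewrite expRD le_eqVlt; apply/orP; left; apply/eqP; ring.
by ring.
Qed.

(** In [S T - x y = (S - x) T + x (T - y)] the two terms have constants [3 * 4] and [3], which sum
    to 15. The surplus factor [v] or [u] is absorbed by [v <= expR v] or [u <= expR u], and
    [|w| <= 1] keeps the exponents below [3 (u + v)]. *)
Lemma kernel_le_sin_sinh_sub w : nrm w <= 1 ->
  kernel_le (fun p => sin_sinh w p - w ^+ 2 * uv_kernel p) (15 * nrm w ^+ 3) 3.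
Proof.
move=> w1; split.
  apply: measurable_funCD; first exact: measurable_sin_sinh.
  apply: measurable_funCN; apply: measurable_funCM; first exact: measurable_funC_cst.
  exact: measurable_uv_kernel.
move=> [u v] /quadrantP[/= u0 v0]; rewrite /sin_sinh /uv_kernel /=.
have w0 := normc_ge0 w.
set S := sinC _; set T := sinhC _; set x := w * v%:C; set y := w * u%:C.
have -> : S * T - w ^+ 2 * (u * v)%:C = (S - x) * T + x * (T - y).
  by rewrite /x /y rmorphM; ring.
have nx : nrm x = nrm w * v by rewrite normc_scale.
have ny : nrm y = nrm w * u by rewrite normc_scale.
have h1 : nrm (S - x) <= 3 * (nrm w * v) ^+ 2 * expR (nrm w * v).
  by rewrite -nx; exact: sinC_taylor.
have h2 : nrm T <= 4 * (nrm w * u) * expR (2 * (nrm w * u)).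
  by rewrite -ny; exact: normc_sinhC_le.
have h3 : nrm (T - y) <= 3 * (nrm w * u) ^+ 2 * expR (nrm w * u).
  by rewrite -ny; exact: sinhC_taylor.
have v1 : v <= expR v by have := expR_ge1Dx v; lra.
have u1 : u <= expR u by have := expR_ge1Dx u; lra.
have wu : nrm w * u <= u by rewrite ger_pMl.
have wv : nrm w * v <= v by rewrite ger_pMl.
have H1 : nrm ((S - x) * T) <= 12 * nrm w ^+ 3 * (u * v) * expR (3 * (u + v)).
  rewrite Normc.normcM; apply: le_trans (ler_pM (normc_ge0 _) (normc_ge0 _) h1 h2) _.
  rewrite [leLHS](_ : _ = 12 * nrm w ^+ 3 * (u * v) *
    (v * (expR (nrm w * v) * expR (2 * (nrm w * u))))); last by ring.
  rewrite ler_wpM2l //; first by rewrite !mulr_ge0 ?exprn_ge0 // ltW.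
  apply: (@le_trans _ _ (expR v * (expR (nrm w * v) * expR (2 * (nrm w * u))))).
    by rewrite ler_wpM2r // mulr_ge0 ?expR_ge0.
  by rewrite -!expRD ler_expR; lra.
have H2 : nrm (x * (T - y)) <= 3 * nrm w ^+ 3 * (u * v) * expR (3 * (u + v)).
  rewrite Normc.normcM nx; apply: le_trans (ler_wpM2l _ h3) _.
    by rewrite mulr_ge0 // ltW.
  rewrite [leLHS](_ : _ = 3 * nrm w ^+ 3 * (u * v) * (u * expR (nrm w * u))); last by ring.
  rewrite ler_wpM2l //; first by rewrite !mulr_ge0 ?exprn_ge0 // ltW.
  apply: (@le_trans _ _ (expR u * expR (nrm w * u))).
    by rewrite ler_wpM2r // expR_ge0.
  by rewrite -!expRD ler_expR; lra.
apply: le_trans (le_normcD _ _) _; apply: le_trans (lerD H1 H2) _.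
by rewrite -!mulrDl le_eqVlt; apply/orP; left; apply/eqP; ring.
Qed.

Lemma zeta_integrandE w s a n p : (0 < n)%N -> Q p ->
  zeta_integrand w s a%:C n p =
  mellin_integrand (zeta_weight (sin_sinh w)) (zeta_log (a - 1) n) s p.
Proof.
move=> n0 Qp; rewrite -zeta_weight_integrandE // /zeta_integrand.
(* Here [a] being real matters: the base is a positive real, so its power has a real logarithm. *)
have -> : (n%:R * p.1%:C) ^+ 2 + (a%:C - 1) ^+ 2 * p.2%:C ^+ 2 =
    (zeta_base (a - 1) n p)%:C :> R[i].
  by rewrite /zeta_base !(rmorphB, rmorphD, rmorphXn, rmorphM, rmorph1, rmorph_nat).
by rewrite /sin_sinh !mulrA.
Qed.

Lemma zeta_termE w s a n : (0 < n)%N ->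
  zeta_term w s a%:C n = zeta_term_of (a - 1) (sin_sinh w) n s.
Proof.
move=> n0; apply: eq_integralC => p; rewrite inE => Qp; exact: zeta_integrandE.
Qed.

Lemma zeta_partialE w s a : zeta_partial w s a%:C =
  fun N => \sum_(1 <= n < N) zeta_term_of (a - 1) (sin_sinh w) n s : R[i]^o.
Proof.
apply/funext => N; apply: eq_big_nat => n /andP[n0 _]; exact: zeta_termE.
Qed.

Let A0 w : 0 <= 16 * nrm w ^+ 2. Proof. by rewrite mulr_ge0 // sqr_ge0. Qed.
Let c0 w : 0 <= 2 * nrm w. Proof. by rewrite mulr_ge0 // normc_ge0. Qed.

Lemma zeta_nz_is_defined w s a : 1 < Re s -> zeta_nz_defined w s a%:C.
Proof.
move=> s1; split=> [n n0|].
  have := zeta_term_integrable (a - 1) (A0 w) (c0 w) (kernel_le_sin_sinh w) n0 s1.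
  apply: eq_integrableC; first exact: measurable_quadrant.
  by move=> p; rewrite inE => Qp; rewrite zeta_integrandE.
rewrite zeta_partialE; apply: cvgP.
exact: (cvg_zeta_sum (A0 w) (c0 w) (kernel_le_sin_sinh w) s1).
Qed.

Definition zeta_prefactor s : R[i] := 4 / (Num.sqrt pi)%:C * (GammaC ((s + 1) / 2))^-1.

Lemma zeta_nzE w s a : zeta_nz w s a%:C =
  zeta_prefactor s * (w ^- 2 * zeta_sum (a - 1) (sin_sinh w) s).
Proof.
rewrite /zeta_nz /zeta_prefactor zeta_partialE -/(zeta_sum _ _ _).
move: (w ^+ 2) => W; rewrite !invfM -!mulrA; congr (4 * _).
by rewrite [LHS]mulrCA; congr (_ * _); exact: mulrCA.
Qed.

(** The distance to the limit is the modulus of the prefactor times [|w|^-2 O(|w|^3)], hence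
    [O(|w|)]. *)
Lemma cvg_zeta_nz0 s a : 1 < Re s ->
  zeta_nz (w : R[i]^o) s a%:C @[w --> (0 : R[i]^o)^'] -->
  (zeta_prefactor s * zeta_sum (a - 1) uv_kernel s : R[i]^o).
Proof.
move=> s1; have [C HC] : exists C : R, forall w, nrm w <= 1 ->
    nrm (zeta_sum (a - 1) (sin_sinh w) s - w ^+ 2 * zeta_sum (a - 1) uv_kernel s)
    <= nrm w ^+ 3 * C.
  exists (15 * (expR ((3 + Re s + 1) ^+ 2 / 2) * (1 + (Re s - 1)^-1) *
    (2 * \int[@plane_measure R]_(p in Q) quadrant_dom p)%R)) => w w1.
  rewrite -(zeta_sum_sub (a - 1) _ (A0 w) (c0 w) (kernel_le_sin_sinh w)
    ler01 (lexx 0) kernel_le_uv s1).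
  apply: le_trans (normc_zeta_sum_le (a - 1) _ _ (kernel_le_sin_sinh_sub w1) s1) _ => //.
    by rewrite mulr_ge0 // exprn_ge0 // normc_ge0.
  by rewrite [leRHS]mulrA (mulrC _ 15).
pose M := nrm (zeta_prefactor s) * `|C| + 1.
have M0 : 0 < M by rewrite ltr_wpDl // mulr_ge0 // normc_ge0.
apply/cvg_normcP => e e0.
pose r := Num.min 1 (e / M); have r0 : 0 < r by rewrite lt_min ltr01 divr_gt0.
rewrite near_withinE; apply/nbhs_ballP; exists (r%:C) => /=; first by rewrite ltcR.
move=> w; rewrite -ball_normE /= sub0r normrN normr_normcE ltcR lt_min => /andP[w1 we] w0.
have nw : 0 < nrm w by rewrite normc_gt0.
rewrite zeta_nzE -mulrBr Normc.normcM.
set Zw := zeta_sum _ (sin_sinh w) s; set Z0 := zeta_sum _ uv_kernel s.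
have -> : Z0 - w ^- 2 * Zw = - (w ^- 2 * (Zw - w ^+ 2 * Z0)).
  by rewrite [in RHS]mulrBr mulKf ?opprB // expf_neq0.
have nV : nrm (w ^- 2) = (nrm w ^+ 2)^-1 by rewrite Normc.normcV normcX.
rewrite normcN [X in _ * X < _]Normc.normcM nV.
have H : (nrm w ^+ 2)^-1 * nrm (Zw - w ^+ 2 * Z0) <= nrm w * `|C|.
  rewrite ler_pdivrMl ?exprn_gt0 //; apply: le_trans (HC w (ltW w1)) _.
  by rewrite mulrA -exprSr ler_wpM2l ?exprn_ge0 ?ler_norm // ltW.
apply: le_lt_trans (ler_wpM2l (normc_ge0 _) H) _.
move: we; rewrite ltr_pdivlMr // => we; apply: le_lt_trans we.
by rewrite mulrCA ler_wpM2l ?(ltW nw) // lerDl.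
Qed.

Definition zeta_kernel w : R * R -> R[i] := if w == 0 then uv_kernel else sin_sinh w.

(** The boolean exponent makes the factor [w^-2] equal to 1 at [w = 0], so that one formula serves
    both cases. *)
Lemma hurwitz_zetaE w s a : 1 < Re s -> hurwitz_zeta w s a%:C =
  zeta_prefactor s * (w ^- 2 ^ (w != 0) * zeta_sum (a - 1) (zeta_kernel w) s).
Proof.
move=> s1; rewrite /hurwitz_zeta /zeta_kernel; case: eqP => [_|_] /=.
  rewrite expr0z mul1r; apply: cvg_lim; first exact: norm_hausdorff.
  exact: cvg_zeta_nz0.
by rewrite expr1z zeta_nzE.
Qed.

Lemma derivable_zeta_kernel_sum w a (s : R[i]^o) : 1 < Re s ->
  derivable (zeta_sum (a - 1) (zeta_kernel w) : R[i]^o -> R[i]^o) s 1.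
Proof.
rewrite /zeta_kernel; case: eqP => _.
  exact: (derivable_zeta_sum ler01 (lexx 0) kernel_le_uv).
exact: (derivable_zeta_sum (A0 w) (c0 w) (kernel_le_sin_sinh w)).
Qed.

Lemma derivable_zeta_prefactor (s : R[i]^o) : 1 < Re s ->
  derivable (zeta_prefactor : R[i]^o -> R[i]^o) s 1.
Proof.
move=> s1; have half (z : R[i]) : z / 2 = (2^-1 : R)%:C * z.
  by rewrite mulrC fmorphV /= rmorph_nat.
have G0 : GammaC ((s + 1) / 2) != 0.
  by apply: GammaC_neq0; rewrite half ReZl ReD /=; lra.
pose G (z : R[i]^o) : R[i]^o := GammaC ((z + 1) / 2).
exact: (@derivable_scaleC _ _ (fun z => (G z)^-1) s
  (@derivable_invC _ G s G0 (derivable_GammaC_half s1))).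
Qed.

Lemma open_Re_gt1 : open ([set s | 1 < Re s] : set R[i]^o).
Proof.
rewrite openE => s /= s1; apply/nbhs_ballP; exists ((Re s - 1)%:C) => /=.
  by rewrite ltcR; lra.
move=> z; rewrite -ball_normE /= normr_normcE ltcR => sz.
have := normcRe (s - z); rewrite ReD ReN => h.
by have := le_lt_trans (le_trans (ler_norm _) h) sz; lra.
Qed.

End HurwitzZetaAnalytic.

Unset Implicit Arguments.
Set Strict Implicit.
Set Printing Implicit Defensive.

Theorem theorem1p1 (R : realType) (w : R[i]) (a : R) :
  (forall s : R[i], 1 < complex.Re s -> hurwitz_zeta_defined w s a%:C) /\
  analytic_on [set s : R[i] | 1 < complex.Re s]
    (fun s => hurwitz_zeta w s a%:C).
Proof.
split=> [s s1|].
  rewrite /hurwitz_zeta_defined; case: ifP => _; last exact: zeta_nz_is_defined.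
  split; last by apply: cvgP; exact: cvg_zeta_nz0.
  by apply: nearW => w'; exact: zeta_nz_is_defined.
split; first exact: open_Re_gt1.
move=> s /= s1.
have D1 := derivable_zeta_prefactor s1.
have D2 := derivable_zeta_kernel_sum (w := w) (a := a) s1.
have D := @derivable_mulC _ (zeta_prefactor : R[i]^o -> R[i]^o) _ s D1
  (@derivable_scaleC _ (w ^- 2 ^ (w != 0)) _ s D2).
(* The product formula is available only for [Re z > 1]; as this half-plane is open, it holds near
   [s], which suffices for differentiability at [s]. *)
apply: near_eq_derivable D; near=> z; rewrite hurwitz_zetaE //.
by near: z; exact: (open_nbhs_nbhs (conj open_Re_gt1 s1)).
Unshelve. all: by end_near. Qed.
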